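(* There exists a $0$-dimensional linearly ordered Valdivia compact space $K$ with the following properties: (1) $K$ is nowhere first countable; in fact every nonempty open interval of $K$ contains both a copy of $\omega_1+1$ and a copy of $1+\omega_1^{-1}$. (2) Every nonempty clopen subset of $K$ is order isomorphic to $K$. (3) Every linearly ordered Valdivia compact space is an order preserving image of $K$.
   Context: Linearly ordered spaces are nonempty and carry the order topology. A compact space $X$ is Valdivia compact if for some $\kappa$ there is an embedding $X\subseteq[0,1]^\kappa$ such that $X=\operatorname{cl}(X\cap\Sigma(\kappa))$, where $\Sigma(\kappa)=\{x\in[0,1]^\kappa: |\{\alpha<\kappa: x(\alpha)\neq 0\}|\le\aleph_0\}$. A linearly ordered Valdivia compact space is a compact linearly ordered space which (as a topological space) is Valdivia compact. A space is nowhere first countable if all its first countable subsets have empty interior. $X^{-1}$ denotes $X$ with the reversed order, $1$ is the one-point order, and $X+Y$ is the ordered sum (all of $X$ below all of $Y$). A copy of a linearly ordered compact space $Z$ in $K$ is the image of $Z$ under a topological embedding that is strictly order preserving. In (2) clopen subsets carry the order inherited from $K$. A space $X$ is an order preserving image of $K$ if there is a continuous surjection $f\colon K\to X$ with $x\le y\Rightarrow f(x)\le f(y)$ (between compact linearly ordered spaces, order preserving surjections are automatically continuous). *)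

(* Defs.v *)
From HB Require Import structures.
From mathcomp Require Import all_boot all_order all_algebra.
From mathcomp Require Import all_classical all_reals all_analysis.
From mathcomp Require wochoice.

Set Implicit Arguments.
Unset Strict Implicit.
Unset Printing Implicit Defensive.

Import Order.TTheory GRing.Theory Num.Theory.
Import numFieldNormedType.Exports.

Local Open Scope classical_set_scope.
Local Open Scope ring_scope.

Definition topological_embedding (X Y : topologicalType) (f : X -> Y) : Prop :=
  [/\ injective f, continuous f &
      forall U : set X, open U -> exists2 V : set Y, open V & U = f @^-1` V].

(* [zero_dimensional] in MathComp-Analysis only asks that clopen sets separate
   points; this is the usual notion, with a base of clopen sets. *)
Definition has_clopen_base (X : topologicalType) : Prop :=
  basis (@clopen X).

Definition first_countable (X : topologicalType) : Prop :=
  forall x : X, exists B : set (set X),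
    [/\ countable B, B `<=` nbhs x &
        forall U, nbhs x U -> exists2 V, B V & V `<=` U].

(* [set_type A] carries the subspace topology. *)
Definition nowhere_first_countable (X : topologicalType) : Prop :=
  forall A : set X, first_countable (set_type A) -> A^° = set0.

(* The cube [0,1]^I and its Sigma-product are taken inside R^I with the product
   topology; the cube being closed there, closures are the same. *)
Definition unit_cube (R : realType) (I : Type) : set {ptws I -> R} :=
  [set x | forall i, 0 <= x i <= 1].

Definition sigma_product (R : realType) (I : Type) : set {ptws I -> R} :=
  [set x | unit_cube x /\ countable [set i | x i != 0]].

Definition valdivia_compact (R : realType) (X : topologicalType) : Prop :=
  compact [set: X] /\
  exists (I : Type) (h : X -> {ptws I -> R}),
    [/\ topological_embedding h,
        range h `<=` @unit_cube R I &
        range h = closure (range h `&` @sigma_product R I)].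

Definition linearly_ordered_valdivia_compact (R : realType)
    (d : Order.disp_t) (X : orderTopologicalType d) : Prop :=
  [set: X] !=set0 /\ valdivia_compact R X.

Definition ordered_sum (A B : Type) : Type := (A + B)%type.

Fact ordered_sum_display : Order.disp_t.
Proof. exact: Order.Disp tt tt. Qed.

Section OrderedSum.
Context {d d' : Order.disp_t} {A : orderType d} {B : orderType d'}.

Definition ordered_sum_le (x y : ordered_sum A B) : bool :=
  match x, y with
  | inl a, inl a' => (a <= a')%O
  | inl _, inr _ => true
  | inr _, inl _ => false
  | inr b, inr b' => (b <= b')%O
  end.

Fact ordered_sum_refl : reflexive ordered_sum_le.
Proof. by case=> x /=. Qed.

Fact ordered_sum_anti : antisymmetric ordered_sum_le.
Proof. by case=> x [] y //= /le_anti ->. Qed.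

Fact ordered_sum_trans : transitive ordered_sum_le.
Proof. by case=> y [] x [] z //=; apply: le_trans. Qed.

Fact ordered_sum_total : total ordered_sum_le.
Proof. by case=> x [] y //=; apply: le_total. Qed.

HB.instance Definition _ := Choice.copy (ordered_sum A B) (A + B)%type.
HB.instance Definition _ := Order.Le_isPOrder.Build ordered_sum_display
  (ordered_sum A B) ordered_sum_refl ordered_sum_anti ordered_sum_trans.
HB.instance Definition _ := Order.POrder_isTotal.Build ordered_sum_display
  (ordered_sum A B) ordered_sum_total.

End OrderedSum.

(* W has the order type of the first uncountable ordinal. *)
Definition is_omega1 (d : Order.disp_t) (W : orderType d) : Prop :=
  [/\ wochoice.well_order (<=%O : rel W),
      ~ countable [set: W] &
      forall w : W, countable [set v : W | (v < w)%O]].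

Definition contains_copy (d d' : Order.disp_t) (Z : orderTopologicalType d)
    (K : orderTopologicalType d') (U : set K) : Prop :=
  exists g : Z -> K,
    [/\ topological_embedding g, {homo g : x y / (x < y)%O} & range g `<=` U].

Definition contains_omega1_succ (d : Order.disp_t)
    (K : orderTopologicalType d) (U : set K) : Prop :=
  exists (e : Order.disp_t) (W : orderType e),
    is_omega1 W /\ contains_copy (order_topology (ordered_sum W 'I_1)) U.

Definition contains_succ_omega1_rev (d : Order.disp_t)
    (K : orderTopologicalType d) (U : set K) : Prop :=
  exists (e : Order.disp_t) (W : orderType e),
    is_omega1 W /\ contains_copy (order_topology (ordered_sum 'I_1 W^d)) U.

Definition order_isomorphic_to_subset (d d' : Order.disp_t)
    (K : porderType d) (L : porderType d') (C : set L) : Prop :=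
  exists f : K -> L, {mono f : x y / (x <= y)%O} /\ range f = C.

Definition order_preserving_image (d d' : Order.disp_t)
    (K : orderTopologicalType d) (X : orderTopologicalType d') : Prop :=
  exists f : K -> X,
    [/\ continuous f, range f = [set: X] & {homo f : x y / (x <= y)%O}].

(* Main.v *)
(* Let G be the group of finitely supported functions from an index set of type
   omega_1 to the rationals, ordered lexicographically, and let e be its first
   basis vector. The space K consists of the cuts of the interval (0, e) of G.
   All open intervals of G are isomorphic to (0, e) by shifting indices, hence so
   are all clopen convex pieces of K, and a + e_i, b - e_i give monotone
   omega_1-sequences in any interval (a, b). Dropping the last basis vector of an
   element, or all those beyond a countable index, yields the coordinates and the
   retractions that make K Valdivia.

   For a Valdivia X inside a cube, countable coordinate sets S closed under
   choosing ordered pairs of Sigma-points in basic boxes carry increasing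
   retractions x |-> x 1_S. Along a suitable omega_1-chain of such sets the
   retractions separate the points of X, because a nontrivial fibre always lies
   over a Sigma-point. The initial segments of X cut out by boxes form omega_1
   countable levels, and each new one has a nearest earlier segment just below or
   just above it. So they embed in [0, e], each infinitesimally close to that
   neighbour, and a cut of G determines a point of X as an infimum. *)
Require Import Defs.
From HB Require Import structures.
From mathcomp Require Import all_boot all_order all_algebra.
From mathcomp Require Import all_classical all_reals all_analysis.
From mathcomp Require wochoice.

Set Implicit Arguments.
Unset Strict Implicit.
Unset Printing Implicit Defensive.

Import Order.TTheory GRing.Theory Num.Theory.
Import numFieldNormedType.Exports.

Local Open Scope classical_set_scope.

(** * The first uncountable ordinal *)

(** The shape of the group is forced from several sides. Division by a leading coefficient makes all
    its intervals alike; countable coefficients and finite supports leave only countably many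
    elements below a given index, so that truncated cuts have countable support; finite supports
    give each nonzero element a last index. The index type is a product with [nat] because every
    level of segments needs countably many indices of its own. The obstacle in an arbitrary [X] is
    that its cube may have any number of coordinates, whereas the chain consists of omega_1
    countable sets and need not exhaust them. Linearity helps: a Sigma-point is determined among all
    points of [X] by countably many coordinates, and at each stage only countably many points carry
    a fibre that a box cuts off, so their determining coordinates can be added at the next stage. *)

Lemma countableS (T : Type) (A B : set T) : A `<=` B -> countable B -> countable A.
Proof. by move=> /subset_card_le; apply: sub_countable. Qed.

Lemma countableU (T : Type) (A B : set T) :
  countable A -> countable B -> countable (A `|` B).
Proof.
by move=> cA cB; rewrite -bigcup2E; apply: bigcup_countable => // -[|[|i]] _ //=.
Qed.

Lemma countable_img (T U : Type) (f : T -> U) (A : set T) :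
  countable A -> countable (f @` A).
Proof. exact: card_le_trans (card_image_le _ _). Qed.

Lemma countable_inj_preimage (T U : Type) (f : T -> U) (A : set T) (B : set U) :
  injective f -> (forall x, A x -> B (f x)) -> countable B -> countable A.
Proof.
move=> fi AB /countable_injP [g gi]; apply/countable_injP.
by exists (g \o f) => x y /set_mem Ax /set_mem Ay /= /gi; rewrite !inE => /(_ (AB _ Ax) (AB _ Ay)) /fi.
Qed.

(** [F] is given a total function with default value [a0] off the predecessors, which keeps
    transfinite recursions free of dependent types. *)
Lemma wf_recursion (T A : Type) (lt : T -> T -> Prop) (a0 : A)
    (F : T -> (T -> A) -> A) : well_founded lt ->
  exists f : T -> A, forall x, f x = F x (fun y => if `[< lt y x >] then f y else a0).
Proof.
move=> wf.
pose body x (rec : forall y, lt y x -> A) :=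
  F x (fun y => if pselect (lt y x) is left h then rec y h else a0).
exists (Fix wf (fun=> A) body) => x; rewrite Fix_eq; last first.
  move=> y f g fg; congr (F y _); apply/funext => z.
  by case: pselect.
congr (F x _); apply/funext => y; rewrite /asbool.
by case: pselect.
Qed.

Section Omega1.
Context {d : Order.disp_t} {W : orderType d}.
Hypothesis W1 : is_omega1 W.

Lemma omega1_min (A : set W) : A !=set0 ->
  exists2 m, A m & forall x, A x -> (m <= x)%O.
Proof.
case: W1 => wo _ _ [a Aa].
have [|m [[mA minm] _]] := wo (fun x => `[< A x >]).
  by exists a; apply/asboolP.
exists m; first by move/asboolP: mA.
by move=> x Ax; apply: minm; apply/asboolP.
Qed.

Lemma omega1_wf : well_founded (fun u v : W => (u < v)%O).
Proof.
move=> v; apply: contrapT => nv.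
have [m mA mmin] := @omega1_min [set v | ~ Acc (fun u v : W => (u < v)%O) v]
  (ex_intro _ v nv).
apply: mA; constructor => u um; apply: contrapT => /mmin.
by rewrite leNgt um.
Qed.

Lemma omega1_le_countable (v : W) : countable [set u | (u <= v)%O].
Proof.
case: W1 => _ _ /(_ v) cv.
apply: (@countableS _ _ ([set u | (u < v)%O] `|` [set v])); last exact: countableU.
by move=> u /=; rewrite le_eqVlt => /orP[/eqP->|]; [right|left].
Qed.

Lemma omega1_bounded (A : set W) : countable A ->
  exists v, forall a, A a -> (a < v)%O.
Proof.
move=> cA; apply: contrapT => nv; case: W1 => _ nW _; apply: nW.
apply: (@countableS _ _ (\bigcup_(a in A) [set u | (u <= a)%O])).
  move=> u _; apply: contrapT => nu; apply: nv; exists u.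
  by move=> a Aa; rewrite ltNge; apply/negP => ua; apply: nu; exists a.
by apply: bigcup_countable => // a _; apply: omega1_le_countable.
Qed.

Lemma omega1_bounded_nat (a : nat -> W) : exists v, forall n, (a n < v)%O.
Proof.
have [|v hv] := @omega1_bounded (range a); last by exists v => n; apply: hv; exists n.
exact: countable_img.
Qed.

Lemma omega1_succ (v : W) : exists2 w, (v < w)%O & forall u, (u < w)%O = (u <= v)%O.
Proof.
have [w0 /(_ 0%N) vw0] := omega1_bounded_nat (fun=> v).
have [w vw minw] := @omega1_min [set w | (v < w)%O] (ex_intro _ w0 vw0).
exists w => // u; apply/idP/idP => [uw|]; last by move/le_lt_trans; apply.
by rewrite leNgt; apply/negP => /minw; rewrite leNgt uw.
Qed.

(* [f] maps [v] to the least index at or above [c] that lies strictly above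
   all the earlier values; a value missed by [f] would bound the whole range of
   [f], which is uncountable. *)
Lemma omega1_final_segment (c : W) : exists f : W -> W,
  [/\ {homo f : u v / (u < v)%O}, forall v, (c <= f v)%O &
      forall w, (c <= w)%O -> exists v, f v = w].
Proof.
have hex v (f : W -> W) : exists m, ((c <= m)%O /\ forall u, (u < v)%O -> (f u < m)%O) /\
    forall x, (c <= x)%O -> (forall u, (u < v)%O -> (f u < x)%O) -> (m <= x)%O.
  have [|b hb] := @omega1_bounded ([set c] `|` f @` [set u | (u < v)%O]).
    by apply: countableU => //; apply: countable_img; case: W1.
  have [|m mA mmin] := @omega1_min [set m | (c <= m)%O /\ forall u, (u < v)%O -> (f u < m)%O].
    exists b; split; first by apply: ltW; apply: hb; left.
    by move=> u uv; apply: hb; right; exists u.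
  by exists m; split => // x h1 h2; apply: mmin.
have {hex} [F FP] : exists F : W -> (W -> W) -> W, forall v f,
    ((c <= F v f)%O /\ forall u, (u < v)%O -> (f u < F v f)%O) /\
    forall x, (c <= x)%O -> (forall u, (u < v)%O -> (f u < x)%O) -> (F v f <= x)%O.
  exists (fun v f => sval (cid (hex v f))) => v f; exact: svalP (cid (hex v f)).
have [f fE] := wf_recursion c F omega1_wf.
have f1 v : (c <= f v)%O by rewrite fE; case: (FP v (fun y => if `[< (y < v)%O >] then f y else c)) => -[].
have f2 u v : (u < v)%O -> (f u < f v)%O.
  move=> uv; rewrite (fE v); case: (FP v (fun y => if `[< (y < v)%O >] then f y else c)) => -[_].
  by move=> /(_ u uv) + _; rewrite asboolT.
have f3 v x : (c <= x)%O -> (forall u, (u < v)%O -> (f u < x)%O) -> (f v <= x)%O.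
  move=> cx hx; rewrite fE.
  case: (FP v (fun y => if `[< (y < v)%O >] then f y else c)) => _; apply => // u uv.
  by rewrite asboolT //; apply: hx.
exists f; split => // w cw; apply: contrapT => nw.
have fw v : (f v < w)%O.
  elim/(well_founded_ind omega1_wf): v => v IH.
  by rewrite lt_neqAle f3 // andbT; apply/eqP => fvw; apply: nw; exists v.
case: W1 => _ nW /(_ w) cw'; apply: nW.
apply: (@countable_inj_preimage _ _ f _ _ _ _ cw') => [u v fuv|u _]; last exact: fw.
by case: (ltgtP u v) => // /f2; rewrite fuv ltxx.
Qed.

End Omega1.

(** * A concrete first uncountable ordinal *)

Lemma uncountable_set_nat : ~ countable [set: set nat].
Proof.
move=> /countable_injP [f fi].
pose D := [set n | exists2 A : set nat, f A = n & ~ A n].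
have [DD|nD] := pselect (D (f D)).
  case: (DD) => A /fi; rewrite !inE => /(_ I I) AD; rewrite AD; exact.
by apply: (nD); exists D.
Qed.

Definition set_nat_le : rel (set nat) :=
  sval (wochoice.well_ordering_principle (set nat)).

Lemma set_nat_le_wo : wochoice.well_order set_nat_le.
Proof. exact: svalP (wochoice.well_ordering_principle (set nat)). Qed.

Lemma set_nat_le_refl : reflexive set_nat_le.
Proof.
move=> x; apply: (wochoice.wo_chain_reflexive (C := predT)) => //.
by move=> A _; apply: set_nat_le_wo.
Qed.

Lemma set_nat_le_total : total set_nat_le.
Proof.
move=> x y; apply: (@wochoice.wo_chainW _ _ predT) => //.
by move=> A _; apply: set_nat_le_wo.
Qed.

Lemma set_nat_le_anti : antisymmetric set_nat_le.
Proof.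
move=> x y; apply: (@wochoice.wo_chain_antisymmetric _ _ predT) => //.
by move=> A _; apply: set_nat_le_wo.
Qed.

Lemma set_nat_le_trans : transitive set_nat_le.
Proof.
move=> y x z xy yz.
have [|m [[mA minm] _]] := @set_nat_le_wo (pred3 x y z); first by exists x; rewrite !inE eqxx.
have mx : set_nat_le m x by apply: minm; rewrite !inE eqxx.
have my : set_nat_le m y by apply: minm; rewrite !inE eqxx ?orbT.
have mz : set_nat_le m z by apply: minm; rewrite !inE eqxx ?orbT.
move: mA; rewrite !inE => /or3P[]/eqP mE; subst m => //.
  by rewrite (@set_nat_le_anti x y) // xy mx.
by rewrite -(@set_nat_le_anti y z) // yz my.
Qed.

(** The power set of [nat] only supplies an uncountable well-ordered type; its elements with
    countable initial segments have order type omega_1. *)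
Definition omega1 : Type :=
  {v : set nat | `[< countable [set u | set_nat_le u v] >]}.

Fact omega1_display : Order.disp_t. Proof. exact: Order.Disp tt tt. Qed.

Definition omega1_le (u v : omega1) : bool := set_nat_le (sval u) (sval v).

Fact omega1_refl : reflexive omega1_le.
Proof. by move=> u; apply: set_nat_le_refl. Qed.

Fact omega1_anti : antisymmetric omega1_le.
Proof. by move=> u v /set_nat_le_anti /val_inj. Qed.

Fact omega1_trans : transitive omega1_le.
Proof. by move=> v u w; apply: set_nat_le_trans. Qed.

Fact omega1_total : total omega1_le.
Proof. by move=> u v; apply: set_nat_le_total. Qed.

HB.instance Definition _ := Choice.copy omega1
  {v : set nat | `[< countable [set u | set_nat_le u v] >]}.
HB.instance Definition _ := Order.Le_isPOrder.Build omega1_display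
  omega1 omega1_refl omega1_anti omega1_trans.
HB.instance Definition _ := Order.POrder_isTotal.Build omega1_display
  omega1 omega1_total.

Lemma omega1P : is_omega1 omega1.
Proof.
split.
- apply: wochoice.antisymmetric_well_order; first exact: le_anti.
  move=> A [a Aa].
  have [|m [[/asboolP [m' Am' m'm] minm] _]] :=
    @set_nat_le_wo (fun x => `[< exists2 a, a \in A & sval a = x >]).
    by exists (sval a); apply/asboolP; exists a.
  exists m'; split => // x Ax; rewrite /Order.le /= /omega1_le m'm; apply: minm.
  by apply/asboolP; exists x.
- move=> cW.
  (* If [omega1] were countable, Cantor would make its complement [B] nonempty, and the initial
     segment of the least element of [B] would be [omega1] with one point added, hence countable. *)
  pose B := [set v | ~ countable [set u | set_nat_le u v]].
  have cB : countable (~` B).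
    apply: countableS (countable_img (sval : omega1 -> set nat) cW).
    by move=> v /contrapT cv; exists (exist _ v (asboolT cv)).
  have [b Bb] : B !=set0.
    apply/set0P/eqP => B0; apply: uncountable_set_nat.
    by move: cB; rewrite B0 setC0.
  have [|m [[/asboolP Bm minm] _]] := @set_nat_le_wo (fun x => `[< B x >]).
    by exists b; apply/asboolP.
  apply: Bm; apply: (@countableS _ _ (~` B `|` [set m])); last exact: countableU.
  move=> u um; have [Bu|] := pselect (B u); last by left.
  right; apply: set_nat_le_anti; apply/andP; split => //.
  by apply: minm; apply/asboolP.
- move=> w; have /asboolP cw := svalP w.
  by apply: (countable_inj_preimage val_inj) cw => u /ltW.
Qed.

(** omega_1 copies of omega in a row, again of type omega_1: a level, then a slot inside the
    level. *)
Definition oindex : Type := (omega1 *l nat)%type.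
HB.instance Definition _ := Order.Total.on oindex.

Lemma oindexP : is_omega1 oindex.
Proof.
split.
- apply: wochoice.antisymmetric_well_order; first exact: le_anti.
  move=> A [a Aa].
  have [|m [k mk] minm] := omega1_min omega1P (A := [set v : omega1 | exists k : nat, ((v, k) : oindex) \in A]).
    by exists a.1, a.2; case: a Aa.
  have ek : exists k : nat, ((m, k) : oindex) \in A by exists k.
  have kA := ex_minnP ek; case: kA => k' k'A k'min.
  exists (m, k'); split => // -[v l] vl; rewrite lexi_pair.
  have mv : (m <= v)%O by apply: minm; exists l.
  rewrite mv /=; apply/implyP => vm; apply: k'min.
  by have /eqP <- : v == m by rewrite eq_le mv vm.
- move=> cV; case: omega1P => _ + _; apply.
  by apply: (@countable_inj_preimage _ _ (fun u => (u, 0%N) : oindex)) cV => // u v [].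
- move=> [w l].
  apply: (@countableS _ _ ([set u | (u <= w)%O] `*` setT)).
    by move=> -[u k] /=; rewrite ltxi_pair => /andP[uw _].
  have cw := omega1_le_countable omega1P w.
  by apply: countableX cw _; apply: countableP.
Qed.

(** * The lexicographic group *)

Local Open Scope ring_scope.

Lemma oindex_has_min : exists m : oindex, forall v, (m <= v)%O.
Proof.
have [v _] : [set: oindex] !=set0.
  apply/set0P/eqP => V0; case: oindexP => _ + _; apply.
  by rewrite V0.
by have [|m _ hm] := omega1_min oindexP (A := setT); [exists v|exists m => u; apply: hm].
Qed.

Definition oindex0 : oindex := sval (cid oindex_has_min).

Lemma oindex0_le v : (oindex0 <= v)%O.
Proof. exact: (svalP (cid oindex_has_min)). Qed.

Definition finite_support : {pred (oindex -> rat)} :=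
  [pred g : oindex -> rat | `[< finite_set [set v | g v != 0] >]].

Fact finite_support_zmod_closed : zmod_closed finite_support.
Proof.
split.
  by apply/asboolP; rewrite (_ : [set _ | _] = set0) // -subset0 => v /eqP; apply.
move=> f g /asboolP ff /asboolP fg; apply/asboolP.
apply: (@sub_finite_set _ _ ([set v | f v != 0] `|` [set v | g v != 0])).
  move=> v /= h; apply/orP; apply: contraNT h; rewrite negb_or !negbK => /andP[/eqP f0 /eqP g0].
  by rewrite (_ : (f - g) v = f v - g v) // f0 g0 subr0.
by rewrite finite_setU.
Qed.

HB.instance Definition _ := GRing.isZmodClosed.Build (oindex -> rat) finite_support
  finite_support_zmod_closed.

Record lexgrp := Lexgrp { lexfun :> oindex -> rat; _ : lexfun \in finite_support }.

HB.instance Definition _ := [isSub for lexfun].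
HB.instance Definition _ := [Choice of lexgrp by <:].
HB.instance Definition _ := [SubChoice_isSubZmodule of lexgrp by <:].

Lemma lexgrpP (x y : lexgrp) : (forall v, x v = y v) -> x = y.
Proof. by move=> xy; apply: val_inj; apply/funext. Qed.

Lemma lexgrp_fin (x : lexgrp) : finite_set [set v | x v != 0].
Proof. by case: x => f /= /asboolP. Qed.

Lemma mk_lexgrp (f : oindex -> rat) : finite_set [set v | f v != 0] ->
  exists x : lexgrp, lexfun x = f.
Proof. by move=> /asboolP h; exists (Lexgrp h). Qed.

Lemma lexD (x y : lexgrp) v : (x + y) v = x v + y v. Proof. by []. Qed.
Lemma lexN (x : lexgrp) v : (- x) v = - x v. Proof. by []. Qed.
Lemma lexB (x y : lexgrp) v : (x - y) v = x v - y v. Proof. by []. Qed.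
Lemma lex0 v : (0 : lexgrp) v = 0. Proof. by []. Qed.

Definition lexlt (x y : lexgrp) : bool :=
  `[< exists2 v, forall u, (u < v)%O -> x u = y u & x v < y v >].

Fact lexlt_irr : irreflexive lexlt.
Proof. by move=> x; apply/asboolP => -[v _]; rewrite ltxx. Qed.

Fact lexlt_trans : transitive lexlt.
Proof.
move=> y x z /asboolP [v xyv ltv] /asboolP [w yzw ltw]; apply/asboolP.
case: (ltgtP v w) => [vw|wv|vw].
- exists v; first by move=> u uv; rewrite xyv // yzw // (lt_trans uv).
  by rewrite -yzw.
- exists w; first by move=> u uw; rewrite xyv ?yzw // (lt_trans uw).
  by rewrite xyv.
- subst w; exists v; first by move=> u uv; rewrite xyv ?yzw.
  exact: lt_trans ltv ltw.
Qed.

HB.instance Definition _ := Order.Lt_isPOrder.Build ring_display lexgrp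
  lexlt_irr lexlt_trans.

Lemma lexltP (x y : lexgrp) :
  reflect (exists2 v, forall u, (u < v)%O -> x u = y u & x v < y v) (x < y)%O.
Proof. exact: asboolP. Qed.

Fact lexgrp_total : total (<=%O : rel lexgrp).
Proof.
move=> x y; have [->|/eqP nxy] := eqVneq x y; first by rewrite lexx.
have [|v /eqP nv minv] := omega1_min oindexP (A := [set v | x v != y v]).
  apply/set0P/eqP => e0; apply: nxy; apply: lexgrpP => v; apply: contrapT => /eqP h.
  by have : [set v | x v != y v] v by []; rewrite e0.
have eqv u : (u < v)%O -> x u = y u.
  by move=> uv; apply: contrapT => /eqP /minv; rewrite leNgt uv.
case: (ltgtP (x v) (y v)) => // h; apply/orP; [left|right]; apply: ltW; apply/lexltP.
  by exists v.
by exists v => // u /eqv.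
Qed.

HB.instance Definition _ := Order.POrder_isTotal.Build ring_display lexgrp
  lexgrp_total.

Lemma lex_ltD2r (z x y : lexgrp) : (x + z < y + z)%O = (x < y)%O.
Proof.
apply/lexltP/lexltP => -[v h1 h2]; exists v.
- by move=> u /h1; rewrite !lexD => /addIr.
- by move: h2; rewrite !lexD ltrD2r.
- by move=> u /h1; rewrite !lexD => ->.
- by rewrite !lexD ltrD2r.
Qed.

Lemma lex_ltD2l (z x y : lexgrp) : (z + x < z + y)%O = (x < y)%O.
Proof. by rewrite ![z + _]addrC lex_ltD2r. Qed.

Lemma lex_subgt0 (x y : lexgrp) : (0 < y - x)%O = (x < y)%O.
Proof. by rewrite -[LHS](lex_ltD2r x) add0r subrK. Qed.

Lemma lex_ltBC (x y z : lexgrp) : (x < y - z)%O = (z < y - x)%O.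
Proof. by rewrite -lex_subgt0 -[RHS]lex_subgt0 addrAC. Qed.

Fact lexdelta_subproof (v : oindex) :
  (fun u : oindex => if u == v then 1 else 0 : rat) \in finite_support.
Proof.
apply/asboolP; apply: (@sub_finite_set _ _ [set v]) => // u /=.
by case: (u =P v) => // _ /eqP; case.
Qed.

Definition lexdelta (v : oindex) : lexgrp := Lexgrp (lexdelta_subproof v).

Lemma lexdeltaE v u : lexdelta v u = if u == v then 1 else 0.
Proof. by []. Qed.

(** A basis vector past the leading index is infinitesimal against the element. Density, the
    omega_1-sequences and the placing of segments all rest on this. *)
Lemma lexdelta_lt_lead (x : lexgrp) v w : (forall u, (u < v)%O -> x u = 0) ->
  0 < x v -> (v < w)%O -> (lexdelta w < x)%O.
Proof.
move=> x0 xv vw; apply/lexltP; exists v => [u uv|]; rewrite lexdeltaE.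
  by rewrite lt_eqF ?x0 // (lt_trans uv).
by rewrite lt_eqF.
Qed.

Lemma lexdelta_lt u v : (u < v)%O -> (lexdelta v < lexdelta u)%O.
Proof.
by apply: lexdelta_lt_lead => [w wu|]; rewrite lexdeltaE ?eqxx // lt_eqF.
Qed.

Lemma lexdelta_gt0 v : (0 < lexdelta v)%O.
Proof.
apply/lexltP; exists v => [u uv|]; rewrite lexdeltaE; first by rewrite lt_eqF.
by rewrite eqxx.
Qed.

(** * The space of cuts *)

Lemma order_nbhs_option (d : Order.disp_t) (X : orderTopologicalType d) (x : X)
    (U : set X) : nbhs x U -> exists l r : option X,
  [/\ forall a, l = Some a -> (a < x)%O, forall b, r = Some b -> (x < b)%O &
      forall z, (forall a, l = Some a -> (a < z)%O) ->
        (forall b, r = Some b -> (z < b)%O) -> U z].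
Proof.
rewrite itv_nbhsE => -[[l r] [oi xi] iU].
exists (if l is BSide _ a then Some a else None), (if r is BSide _ a then Some a else None).
move: oi xi iU; case: l => [[] a|[]]; case: r => [[] b|[]] //= _; rewrite in_itv /=.
- by move=> /andP[ax xb] iU; split => [_ [<-]|_ [<-]|z /(_ _ erefl) az /(_ _ erefl) zb] //; apply: iU; rewrite /= in_itv /= az zb.
- by rewrite andbT => ax iU; split => [_ [<-]|//|z /(_ _ erefl) az _] //; apply: iU; rewrite /= in_itv /= az.
- by move=> xb iU; split => [//|_ [<-]|z _ /(_ _ erefl) zb] //; apply: iU; rewrite /= in_itv /= zb.
- by move=> _ iU; split => // z _ _; apply: iU; rewrite /= in_itv.
Qed.

(* The cuts of the interval between [0] and [lexdelta oindex0], extended downwards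
   to cuts of the whole group. *)
Definition is_cut : {pred (set lexgrp)} := fun A : set lexgrp =>
  `[< [/\ forall x y, y <= x -> A x -> A y, A 0 & ~ A (lexdelta oindex0)] >].

Record cut := Cut { cutset :> lexgrp -> Prop; _ : (cutset : set lexgrp) \in is_cut }.

HB.instance Definition _ := [isSub of cut for cutset].
HB.instance Definition _ := [Choice of cut by <:].

Lemma cut_down (A : cut) x y : y <= x -> A x -> A y.
Proof. by case: A => A /= /asboolP [h _ _]; apply: h. Qed.

Lemma cut0 (A : cut) : A 0.
Proof. by case: A => A /= /asboolP []. Qed.

Lemma cut1 (A : cut) : ~ A (lexdelta oindex0).
Proof. by case: A => A /= /asboolP []. Qed.

Lemma mk_cut (P : set lexgrp) : (forall x y, y <= x -> P x -> P y) -> P 0 ->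
  ~ P (lexdelta oindex0) -> exists A : cut, cutset A = P.
Proof.
move=> h1 h2 h3; have h : P \in is_cut by apply/asboolP.
by exists (Cut h).
Qed.

Lemma cutP (A B : cut) : (forall x, A x <-> B x) -> A = B.
Proof. by move=> AB; apply: val_inj; apply/funext => x; apply/propext. Qed.

Lemma cut_lt (A : cut) x y : A x -> ~ A y -> x < y.
Proof. by move=> Ax Ay; rewrite ltNge; apply/negP => /cut_down /(_ Ax). Qed.

Lemma cut_le0 (A : cut) x : x <= 0 -> A x.
Proof. by move=> /cut_down; apply; apply: cut0. Qed.

Lemma cut_ge1 (A : cut) x : lexdelta oindex0 <= x -> ~ A x.
Proof. by move=> h Ax; apply: (@cut1 A); apply: cut_down h Ax. Qed.

Definition cut_le (A B : cut) : bool := `[< forall x, A x -> B x >].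

Fact cut_display : Order.disp_t. Proof. exact: Order.Disp tt tt. Qed.

Fact cut_refl : reflexive cut_le.
Proof. by move=> A; apply/asboolP. Qed.

Fact cut_anti : antisymmetric cut_le.
Proof.
move=> A B /andP[/asboolP AB /asboolP BA]; apply: cutP => x.
by split => [/AB|/BA].
Qed.

Fact cut_trans : transitive cut_le.
Proof. by move=> B A C /asboolP AB /asboolP BC; apply/asboolP => x /AB /BC. Qed.

Fact cut_total : total cut_le.
Proof.
move=> A B; have [AB|/existsNP [x /not_implyP [Ax nBx]]] := pselect (forall x, A x -> B x).
  by apply/orP; left; apply/asboolP.
by apply/orP; right; apply/asboolP => y By; apply: cut_down Ax; apply: ltW; apply: cut_lt nBx.
Qed.

HB.instance Definition _ := Order.Le_isPOrder.Build cut_display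
  cut cut_refl cut_anti cut_trans.
HB.instance Definition _ := Order.POrder_isTotal.Build cut_display cut cut_total.

Lemma cut_leP (A B : cut) : reflect (forall x, A x -> B x) (A <= B)%O.
Proof. exact: asboolP. Qed.

Lemma cut_ltP (A B : cut) : reflect (exists2 x, ~ A x & B x) (A < B)%O.
Proof.
rewrite ltNge; apply: (iffP negP) => [nBA|[x nAx Bx]].
  have /existsNP [x /not_implyP [Bx nAx]] : ~ forall x, B x -> A x.
    by move=> BA; apply/nBA/cut_leP.
  by exists x.
by move=> /cut_leP /(_ x Bx).
Qed.

Notation cutspace := (order_topology cut).

Definition cell (x y : lexgrp) : set cutspace := [set A : cut | A x /\ ~ A y].

Lemma mk_cut_le (x : lexgrp) : 0 <= x -> x < lexdelta oindex0 ->
  exists A : cut, forall u, A u <-> u <= x.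
Proof.
move=> x0 x1; have [|||A AE] := @mk_cut [set u | u <= x].
- by move=> u v /= vu; apply: le_trans.
- by [].
- by move=> /=; rewrite leNgt x1.
- by exists A => u; rewrite AE.
Qed.

Lemma mk_cut_lt (x : lexgrp) : 0 < x -> x <= lexdelta oindex0 ->
  exists A : cut, forall u, A u <-> u < x.
Proof.
move=> x0 x1; have [|||A AE] := @mk_cut [set u | u < x].
- by move=> u v /= vu; apply: le_lt_trans.
- by [].
- by move=> /=; rewrite ltNge x1.
- by exists A => u; rewrite AE.
Qed.

(** Inside the interval, [x] makes a jump between the cuts [u < x] and [u <= x], so the cuts
    containing [x] form the open ray above the lower one. Outside, the condition is constant. *)
Lemma cut_mem_open (x : lexgrp) : open [set A : cutspace | (A : cut) x].
Proof.
have [x0|x0] := leP x 0.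
  by rewrite (_ : mkset _ = setT); [exact: openT|rewrite -subTset => A _; exact: cut_le0].
have [x1|x1] := leP (lexdelta oindex0) x.
  rewrite (_ : mkset _ = set0); first exact: open0.
  by rewrite -subset0 => A /=; apply: cut_ge1.
have [B BE] := mk_cut_lt x0 (ltW x1).
rewrite (_ : mkset _ = `]B : cutspace, +oo[%classic); first exact: rray_open.
apply/seteqP; split => A /=; rewrite in_itv /= andbT.
  by move=> Ax; apply/cut_ltP; exists x => // /BE; rewrite ltxx.
by move=> /cut_ltP [y nBy Ay]; apply: cut_down Ay; rewrite leNgt; apply/negP => /BE.
Qed.

Lemma cut_nmem_open (x : lexgrp) : open [set A : cutspace | ~ (A : cut) x].
Proof.
have [x0|x0] := ltP x 0.
  rewrite (_ : mkset _ = set0); first exact: open0.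
  by rewrite -subset0 => A /=; apply; apply: cut_le0; apply: ltW.
have [x1|x1] := leP (lexdelta oindex0) x.
  by rewrite (_ : mkset _ = setT); [exact: openT|rewrite -subTset => A _; exact: cut_ge1].
have [B BE] := mk_cut_le x0 x1.
rewrite (_ : mkset _ = `]-oo, B : cutspace[%classic); first exact: lray_open.
apply/seteqP; split => A /=; rewrite in_itv /=.
  by move=> Ax; apply/cut_ltP; exists x => //; apply/BE.
by move=> /cut_ltP [y nAy /BE yx] Ax; apply: nAy; apply: cut_down yx Ax.
Qed.

Lemma cell_open x y : open (cell x y).
Proof. exact: openI (cut_mem_open x) (cut_nmem_open y). Qed.

Lemma cell_clopen x y : clopen (cell x y).
Proof.
split; first exact: cell_open.
rewrite -openC (_ : ~` _ = [set A : cutspace | ~ (A : cut) x] `|` [set A : cutspace | (A : cut) y]).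
  exact: openU (cut_nmem_open x) (cut_mem_open y).
apply/seteqP; split => A /=.
  by move=> h; have [Ax|] := pselect ((A : cut) x); [right; apply: contrapT => nAy; apply: h|left].
by case=> h [].
Qed.

Lemma cell_nbhs (A : cutspace) (U : set cutspace) : nbhs A U ->
  exists x y, [/\ 0 <= x, y <= lexdelta oindex0, cell x y A & cell x y `<=` U].
Proof.
move=> /order_nbhs_option [l [r [lA rA lrU]]].
have [x [x0 Ax hx]] : exists x, [/\ 0 <= x, (A : cut) x &
    forall B : cut, B x -> forall a, l = Some a -> (a < B)%O].
  case: l lA {lrU} => [C /(_ _ erefl) /cut_ltP [x nCx Ax]|_].
    exists x; split => //.
      by rewrite leNgt; apply/negP => /ltW /cut_le0.
    by move=> B Bx _ [<-]; apply/cut_ltP; exists x.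
  by exists 0; split => //; apply: cut0.
have [y [y1 Ay hy]] : exists y, [/\ y <= lexdelta oindex0, ~ (A : cut) y &
    forall B : cut, ~ B y -> forall a, r = Some a -> (B < a)%O].
  case: r rA {lrU hx} => [C /(_ _ erefl) /cut_ltP [y nAy Cy]|_].
    exists y; split => //.
      by rewrite leNgt; apply/negP => /ltW /cut_ge1 /(_ Cy).
    by move=> B By _ [<-]; apply/cut_ltP; exists y.
  by exists (lexdelta oindex0); split => //; apply: cut1.
exists x, y; split => // B [Bx By]; apply: lrU; [exact: hx|exact: hy].
Qed.

Lemma cutspace_clopen_base : has_clopen_base cutspace.
Proof.
split; first by move=> U [].
move=> A U /cell_nbhs [x [y [_ _ Axy xyU]]].
by exists (cell x y); first by split => //; exact: cell_clopen.
Qed.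

(** An ultrafilter converges to the cut of those group elements that almost all cuts contain. *)
Lemma cutspace_compact : compact [set: cutspace].
Proof.
rewrite compact_ultra => F UF _.
have [|||A AE] := @mk_cut [set x | F [set B : cutspace | (B : cut) x]].
- by move=> x y yx /=; apply: filterS => B; apply: cut_down.
- by apply: filterS filterT => B _; apply: cut0.
- move=> /= F1; have : F set0 by apply: filterS F1 => B /cut1.
  exact: filter_not_empty.
exists (A : cutspace); split => // U /cell_nbhs [x [y [_ _ [Ax Ay] xyU]]].
have {}Ax : F [set B : cutspace | (B : cut) x] by move: Ax; rewrite AE.
have {}Ay : F [set B : cutspace | ~ (B : cut) y].
  have [|//] := in_ultra_setVsetC [set B : cutspace | (B : cut) y] UF.
  by move=> Fy; exfalso; apply: Ay; rewrite AE.
by apply: filterS xyU _; apply: filterI.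
Qed.

(** * Clopen subsets *)

(* The convex subgroup of elements supported at or above the leading index [c]
   of [y - x] is a copy of the whole group, by shifting indices; sending the
   first basis vector to [y - x] makes that copy start with [y - x]. *)
Lemma lexgrp_affine_embedding (x y : lexgrp) : x < y ->
  exists t : lexgrp -> lexgrp, [/\ {homo t : u v / u < v}, t 0 = x,
    t (lexdelta oindex0) = y & forall u, x <= u -> u < y -> exists v, t v = u].
Proof.
move=> xy; have [dl dlE] : exists dl : lexgrp, dl = y - x by exists (y - x).
have /lexltP [c d0 dc] : 0 < dl by rewrite dlE lex_subgt0.
have {}d0 u : (u < c)%O -> dl u = 0 by move=> /d0; rewrite lex0.
rewrite lex0 in dc.
have [f [fh fc fs]] := omega1_final_segment oindexP c.
have fle : {mono f : u v / (u <= v)%O} by apply: le_mono.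
have finj : injective f by apply: inc_inj.
have f0 : f oindex0 = c.
  apply/eqP; rewrite eq_le fc andbT; have [v <-] := fs c (lexx c).
  by rewrite fle oindex0_le.
have [g gP] : exists g, forall w, (c <= w)%O -> f (g w) = w.
  exists (fun w => xget oindex0 [set v | f v = w]) => w /fs [v vw].
  by case: xgetP => [v' -> //|/(_ v)].
have gK v : g (f v) = v by apply: finj; rewrite gP.
pose T (z : lexgrp) w := z oindex0 * dl w + (if (c < w)%O then z (g w) else 0).
have /choice [t tE] : forall z : lexgrp, exists t : lexgrp, lexfun t = T z.
  move=> z; apply: mk_lexgrp.
  apply: (@sub_finite_set _ _ ([set v | dl v != 0] `|` f @` [set v | z v != 0])).
    move=> w /=; rewrite /T; case: ltP => cw h.
      have [dw|] := eqVneq (dl w) 0; last by left.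
      right; exists (g w); last by rewrite gP // ltW.
      by move: h; rewrite dw mulr0 add0r.
    by left; apply: contraNN h => /eqP ->; rewrite mulr0 addr0.
  by rewrite finite_setU; split; [|apply: finite_image]; apply: lexgrp_fin.
have tw z w : t z w = z oindex0 * dl w + (if (c < w)%O then z (g w) else 0).
  by rewrite tE.
exists (fun z => x + t z); split.
- move=> u v /lexltP [w uvw ltw]; rewrite lex_ltD2l; apply/lexltP.
  have [w0|w0] := eqVneq w oindex0.
    subst w; exists c => [w wc|]; rewrite !tw; last by rewrite ltxx !addr0 ltr_pM2r.
    by rewrite d0 // ltNge (ltW wc) !mulr0.
  have {}w0 : (oindex0 < w)%O by rewrite lt_neqAle eq_sym w0 oindex0_le.
  have uv0 : u oindex0 = v oindex0 by apply: uvw.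
  exists (f w) => [w' ww'|]; rewrite !tw uv0; last first.
    have cw : (c < f w)%O by rewrite -f0; apply: fh.
    by rewrite cw gK ltrD2l.
  congr (_ + _); case: ltP => // cw'; apply: uvw.
  by rewrite -(leW_mono fle) gP // ltW.
- rewrite (_ : t 0 = 0) ?addr0 //; apply: lexgrpP => w; rewrite tw !lex0 mul0r add0r.
  by case: ifP.
- rewrite (_ : t _ = dl) ?dlE ?subrKC // -dlE; apply: lexgrpP => w; rewrite tw !lexdeltaE eqxx mul1r.
  case: ltP => cw; last by rewrite addr0.
  case: eqP => [gw|]; last by rewrite addr0.
  by have := gP w (ltW cw); rewrite gw f0 => cE; move: cw; rewrite cE ltxx.
- move=> u xu uy; have [e eE] : exists e : lexgrp, e = u - x by exists (u - x).
  (* A nonzero coordinate before the leading index [c] of [dl] would make the nonnegative element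
     [e] exceed [dl]. *)
  have e0 w : (w < c)%O -> e w = 0.
    move=> wc; have [ux|ux] := eqVneq u x; first by rewrite eE ux subrr.
    have /lexltP [w' e0 ew'] : 0 < e by rewrite eE lex_subgt0 lt_neqAle eq_sym ux.
    case: (leP c w') => cw'; first by rewrite -e0 // (lt_le_trans wc).
    suff : dl < e by rewrite ltNge ltW // eE dlE lex_ltD2r.
    apply/lexltP; exists w' => [v vw'|]; last by rewrite d0.
    by rewrite -e0 // d0 // (lt_trans vw').
  (* Inverse of [T]: the first coordinate is the multiple of [dl] that matches [e] at [c], and the
     remainder is shifted back along [f]. Rational coefficients allow the division. *)
  pose S v := if v == oindex0 then e c / dl c else e (f v) - e c / dl c * dl (f v).
  have [|z zE] := @mk_lexgrp S.
    apply: (@sub_finite_set _ _ ([set oindex0] `|` (f @^-1` [set v | dl v != 0] `|` f @^-1` [set v | e v != 0]))).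
      move=> v /=; rewrite /S; case: (v =P oindex0) => [->|_ h]; first by left.
      right; have [dw|] := eqVneq (dl (f v)) 0; last by left.
      by right; move: h; rewrite dw mulr0 subr0.
    rewrite !finite_setU; split => //; split; apply: finite_preimage; try exact: lexgrp_fin.
      by move=> ? ? _ _; apply: finj.
    by move=> ? ? _ _; apply: finj.
  exists z; apply: lexgrpP => w; rewrite lexD tw zE /S eqxx.
  have -> : u w = x w + e w by rewrite eE lexB addrC subrK.
  congr (_ + _); case: (ltgtP c w) => cw.
  + have -> : (g w == oindex0) = false.
      by apply/eqP => gw; have := gP w (ltW cw); rewrite gw f0 => cE; move: cw; rewrite cE ltxx.
    by rewrite gP 1?ltW // addrC subrK.
  + by rewrite (e0 w) // (d0 w) // mulr0 addr0.
  + by rewrite -cw addr0 divfK // gt_eqF.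
Qed.

(** The affine copy [t] acts on cuts by generating downward closures; pulling back along [t] inverts
    this, because [t] reaches every element between [x] and [y]. *)
Lemma cell_iso (x y : lexgrp) : 0 <= x -> x < y -> y <= lexdelta oindex0 ->
  order_isomorphic_to_subset cutspace (cell x y).
Proof.
move=> x0 xy y1; have [t [th t0 t1 ts]] := lexgrp_affine_embedding xy.
have tle : {mono t : u v / u <= v} by apply: le_mono.
have tlt : {mono t : u v / u < v} by apply: leW_mono.
have /choice [f fE] : forall A : cut, exists B : cut, forall g, B g <-> exists2 a, A a & g <= t a.
  move=> A; have [|||B BE] := @mk_cut [set g | exists2 a, A a & g <= t a].
  - by move=> u v vu /= [a Aa ua]; exists a => //; apply: le_trans ua.
  - by exists 0; rewrite ?t0 //; apply: cut0.
  - move=> [a Aa]; rewrite leNgt => /negP; apply; apply: lt_le_trans y1.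
    by rewrite -t1; apply: th; apply: cut_lt Aa (@cut1 _).
  - by exists B => g; rewrite BE.
have ft A a : f A (t a) <-> A a.
  split; last by move=> Aa; apply/fE; exists a.
  by move=> /fE [b Ab]; rewrite tle => ab; apply: cut_down Ab.
exists f; split.
  move=> A B; apply/cut_leP/cut_leP => AB a.
    by move=> /ft /AB /ft.
  by move=> /fE [b Ab ab]; apply/fE; exists b => //; apply: AB.
apply/seteqP; split => [_ [A _ <-]|B [Bx By]].
  split; first by rewrite -t0; apply/ft; apply: cut0.
  by rewrite -t1 => /ft /cut1.
have [|||A AE] := @mk_cut [set a | (B : cut) (t a)].
- by move=> u v /= vu; apply: cut_down; rewrite tle.
- by rewrite /= t0.
- by rewrite /= t1.
exists A => //; apply: cutP => g; split.
  by move=> /fE [a]; rewrite AE /= => Ba ga; apply: cut_down Ba.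
move=> Bg; apply/fE; have [xg|gx] := leP x g; last first.
  by exists 0; rewrite ?t0; [apply: cut0|apply: ltW].
have [a ag] := ts _ xg (cut_lt Bg By).
by exists a; rewrite ?AE /= ag.
Qed.

Lemma mk_lex_between (x y : lexgrp) : x < y -> exists2 z, x < z & z < y.
Proof.
move=> xy; have /lexltP [c d0 dc] : 0 < y - x by rewrite lex_subgt0.
have [w cw _] := omega1_succ oindexP c.
exists (x + lexdelta w).
  by rewrite -{1}(addr0 x) lex_ltD2l lexdelta_gt0.
rewrite addrC -(lex_ltD2r (- x)) addrK; apply: lexdelta_lt_lead cw => //.
by move=> u /d0; rewrite lex0.
Qed.

(** Splitting at any [x] inside the interval shows the space to be the ordered sum of two cells
    isomorphic to it, so a sum of two copies is again a copy. *)
Lemma iso_sum (C D : set cutspace) : (forall A B, C A -> D B -> (A < B)%O) ->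
  order_isomorphic_to_subset cutspace C -> order_isomorphic_to_subset cutspace D ->
  order_isomorphic_to_subset cutspace (C `|` D).
Proof.
move=> CD [f [fm fC]] [g [gm gD]].
have [x x0 x1] := mk_lex_between (lexdelta_gt0 oindex0).
have [p [pm pE]] := cell_iso (lexx _) x0 (ltW x1).
have [q [qm qE]] := cell_iso (ltW x0) x1 (lexx _).
have hp (A : cutspace) : exists B, ~ (A : cut) x -> p B = A.
  have [|nAx] := pselect ((A : cut) x); first by exists A.
  have [B _ BA] : range p A by rewrite pE; split => //; apply: cut0.
  by exists B.
have hq (A : cutspace) : exists B, (A : cut) x -> q B = A.
  have [Ax|] := pselect ((A : cut) x); last by exists A.
  have [B _ BA] : range q A by rewrite qE; split => //; apply: cut1.
  by exists B.
have {hp} /choice [p' p'K] := hp; have {hq} /choice [q' q'K] := hq.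
pose h (A : cutspace) := if `[< (A : cut) x >] then g (q' A) else f (p' A).
exists h; split.
  move=> A B; rewrite /h; case: asboolP => Ax; case: asboolP => Bx.
  - by rewrite gm -{2}(q'K A) // -{2}(q'K B) // qm.
  - have -> : (A <= B)%O = false by apply/negP => /cut_leP /(_ x Ax).
    apply/negbTE; rewrite -ltNge; apply: CD.
      by rewrite -fC; exists (p' B).
    by rewrite -gD; exists (q' A).
  - have -> : (A <= B)%O by apply: ltW; apply/cut_ltP; exists x.
    apply: ltW; apply: CD.
      by rewrite -fC; exists (p' A).
    by rewrite -gD; exists (q' B).
  - by rewrite fm -{2}(p'K A) // -{2}(p'K B) // pm.
apply/seteqP; split => [_ [A _ <-]|].
  rewrite /h; case: asboolP => Ax; [right; rewrite -gD|left; rewrite -fC].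
    by exists (q' A).
  by exists (p' A).
move=> B [|]; [rewrite -fC|rewrite -gD] => -[A _ <-].
- have [_ nx] : cell 0 x (p A) by rewrite -pE; exists A.
  exists (p A) => //; rewrite /h asboolF //; congr f.
  by apply: (inc_inj pm); rewrite p'K.
- have [nx _] : cell x (lexdelta oindex0) (q A) by rewrite -qE; exists A.
  exists (q A) => //; rewrite /h asboolT //; congr g.
  by apply: (inc_inj qm); rewrite q'K.
Qed.

(* The set of [g] such that all cells [cell 0 y], [y <= g], are good is itself
   a point of the space; a cell around it on which [C] is constant extends it. *)
Lemma clopen_iso (C : set cutspace) : clopen C -> C !=set0 ->
  order_isomorphic_to_subset cutspace C.
Proof.
move=> [oC cC] [A0 CA0].
(* The empty alternative is there because [C] may miss whole cells. *)
pose P x y := C `&` cell x y = set0 \/ order_isomorphic_to_subset cutspace (C `&` cell x y).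
have cellU x y z : x <= y -> y <= z -> C `&` cell x z = (C `&` cell x y) `|` (C `&` cell y z).
  move=> xy yz; rewrite -setIUr; congr (_ `&` _); apply/seteqP; split => A /=.
    by move=> [Ax Az]; have [Ay|nAy] := pselect ((A : cut) y); [right|left].
  move=> [[Ax nAy]|[Ay nAz]]; split => //; first by move=> /(cut_down yz).
  exact: cut_down xy Ay.
have Ptrans x y z : x <= y -> y <= z -> P x y -> P y z -> P x z.
  rewrite /P => xy yz; rewrite (cellU x y z) // => -[->|Pxy] [->|Pyz].
  - by left; rewrite setU0.
  - by right; rewrite set0U.
  - by right; rewrite setU0.
  - right; apply: iso_sum => // A B [_ [_ nA]] [_ [By _]].
    by apply/cut_ltP; exists y.
have P00 : P 0 0 by left; rewrite -subset0 => A [_ []].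
have [|||A AE] := @mk_cut [set g | g <= 0 \/ g < lexdelta oindex0 /\ forall y, 0 < y -> y <= g -> P 0 y].
- move=> x y yx /= [x0|[x1 hx]]; first by left; apply: le_trans x0.
  right; split; first exact: le_lt_trans x1.
  by move=> z z0 zy; apply: hx => //; apply: le_trans yx.
- by left.
- by move=> [|[]]; rewrite ?ltxx // leNgt lexdelta_gt0.
have [u [v [u0 v1 [Au nAv] huv]]] : exists u v, [/\ 0 <= u, v <= lexdelta oindex0,
    cell u v A & cell u v `<=` C \/ cell u v `<=` ~` C].
  have [CA|nCA] := pselect (C A).
    have [|u [v [u0 v1 Auv uvC]]] := @cell_nbhs A C; first exact: open_nbhs_nbhs.
    by exists u, v; split => //; left.
  have [|u [v [u0 v1 Auv uvC]]] := @cell_nbhs A (~` C).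
    by apply: open_nbhs_nbhs; split => //; rewrite openC.
  by exists u, v; split => //; right.
have uv : u < v by apply: cut_lt Au nAv.
have Puy y : u < y -> y <= v -> P u y.
  move=> uy yv; have suv : cell u y `<=` cell u v.
    by move=> B [Bu nBy]; split => // /(cut_down yv).
  case: huv => h; [right|left].
    have -> : C `&` cell u y = cell u y by apply/setIidr => B /suv /h.
    by apply: cell_iso => //; apply: le_trans v1.
  by rewrite -subset0 => B [CB] /suv /h.
have P0u : P 0 u.
  have [u0'|u0'] := @ltP _ lexgrp 0 u; last by have -> : u = 0; [apply/le_anti; rewrite u0 u0'|].
  by move: Au; rewrite AE /= => -[|[_ /(_ u u0' (lexx u))]] //; rewrite leNgt u0'.
have P0y y : 0 < y -> y <= v -> P 0 y.
  move=> y0 yv; have [uy|yu] := ltP u y.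
    by apply: (@Ptrans 0 u y) => //; [exact: ltW|exact: Puy].
  move: Au; rewrite AE /= => -[u0'|[_]]; last exact.
  by move: (lt_le_trans y0 (le_trans yu u0')); rewrite ltxx.
(* If the cell around [A] ended earlier, all [y <= v] would be good and [v] itself would belong to
   [A]. *)
have v1' : v = lexdelta oindex0.
  apply/eqP; rewrite eq_le v1 leNgt; apply/negP => v1'.
  by apply: nAv; rewrite AE /=; right.
have : P 0 v by apply: P0y => //; apply: le_lt_trans uv.
have -> : P 0 v = (C = set0 \/ order_isomorphic_to_subset cutspace C).
  rewrite /P v1' (_ : cell _ _ = setT) ?setIT //.
  by rewrite -subTset => B _; split; [apply: cut0|apply: cut1].
by case=> // C0; rewrite C0 in CA0.
Qed.

(** * Uncountable monotone sequences *)

(** Between total orders a strictly increasing map reflects the order, so an interval around [x] is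
    the preimage of the interval whose ends are the image points. *)
Lemma strict_mono_embedding (d d' : Order.disp_t) (Z : orderTopologicalType d)
    (K : orderTopologicalType d') (g : Z -> K) :
  {homo g : x y / (x < y)%O} -> continuous g -> topological_embedding g.
Proof.
move=> gh gc; have glt : {mono g : x y / (x < y)%O}.
  by apply: leW_mono; apply: le_mono.
split => //; first by apply: inc_inj; apply: le_mono.
move=> U oU; exists (\bigcup_(W in [set W | open W /\ g @^-1` W `<=` U]) W).
  by apply: bigcup_open => W [].
apply/seteqP; split => [x Ux|x [W [_ WU] Wx]]; last exact: WU.
have [l [r [lx rx lrU]]] := order_nbhs_option (open_nbhs_nbhs (conj oU Ux)).
pose L := if l is Some a then `]g a, +oo[%classic else setT.
pose Q := if r is Some b then `]-oo, g b[%classic else setT.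
exists (L `&` Q); last first.
  rewrite /L /Q; split; [case: l lx {lrU L}|case: r rx {lrU Q}] => //= a /(_ _ erefl) h.
    by rewrite in_itv /= glt h.
  by rewrite in_itv /= glt.
split.
  apply: openI; first by rewrite /L; case: (l) => [a|]; [exact: rray_open|exact: openT].
  by rewrite /Q; case: (r) => [a|]; [exact: lray_open|exact: openT].
move=> z [Lz Qz]; apply: lrU => a la.
  by move: Lz; rewrite /L la /= in_itv /= glt andbT.
by move: Qz; rewrite /Q la /= in_itv /= glt.
Qed.

Lemma cutspace_continuous (Z : topologicalType) (g : Z -> cutspace) :
  (forall u, open [set z | (g z : cut) u]) ->
  (forall u, open [set z | ~ (g z : cut) u]) -> continuous g.
Proof.
move=> o1 o2 z U /cell_nbhs [x [y [_ _ [gx gy] xyU]]].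
have : nbhs z ([set z | (g z : cut) x] `&` [set z | ~ (g z : cut) y]).
  by apply: open_nbhs_nbhs; split; [exact: openI|].
by apply: filterS => w; apply: xyU.
Qed.

Lemma ord1_eq (i j : 'I_1) : i = j.
Proof. by rewrite [i]ord1 [j]ord1. Qed.

Lemma ordered_sum_ltl (d d' : Order.disp_t) (A : orderType d) (B : orderType d') (a b : A) :
  ((inl a : ordered_sum A B) < inl b)%O = (a < b)%O.
Proof. by rewrite !ltNge. Qed.

Lemma ordered_sum_ltr (d d' : Order.disp_t) (A : orderType d) (B : orderType d') (a b : B) :
  ((inr a : ordered_sum A B) < inr b)%O = (a < b)%O.
Proof. by rewrite !ltNge. Qed.

(** For [v] past the leading index of [y - x], the elements [y - lexdelta v] increase with [v] and
    stay above [x]. Each [z] goes to the cut generated by those with index strictly before [z];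
    strictness gives continuity at limits and at the top. *)
Lemma cell_omega1_succ (x y : lexgrp) : 0 <= x -> x < y -> y <= lexdelta oindex0 ->
  contains_copy (order_topology (ordered_sum oindex 'I_1)) (cell x y).
Proof.
move=> x0 xy y1; have /lexltP [c d0 dc] : 0 < y - x by rewrite lex_subgt0.
have [w cw _] := omega1_succ oindexP c; have [f [fh fw _]] := omega1_final_segment oindexP w.
pose e b := y - lexdelta (f b).
have eh b b' : (b < b')%O -> e b < e b'.
  by move=> bb'; rewrite /e lex_ltBC opprB addrC subrK; apply/lexdelta_lt/fh.
have xe b : x < e b.
  rewrite /e lex_ltBC; apply: lexdelta_lt_lead dc _; last exact: lt_le_trans (fw b).
  by move=> u /d0; rewrite lex0.
have ey b : e b < y by rewrite /e -lex_subgt0 opprB addrC subrK lexdelta_gt0.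
have /choice [g gE] : forall z : ordered_sum oindex 'I_1, exists A : cut, forall u,
    A u <-> u <= x \/ exists2 b, ((inl b : ordered_sum oindex 'I_1) < z)%O & u <= e b.
  move=> z; have [|||A AE] := @mk_cut [set u | u <= x \/
      exists2 b, ((inl b : ordered_sum oindex 'I_1) < z)%O & u <= e b].
  - move=> u v vu /= [ux|[b bz ub]]; first by left; apply: le_trans ux.
    by right; exists b => //; apply: le_trans ub.
  - by left.
  - move=> [|[b _]]; first by rewrite leNgt (lt_le_trans xy).
    by rewrite leNgt (lt_le_trans (ey b)).
  - by exists A => u; rewrite AE.
have ge (z : ordered_sum oindex 'I_1) b : g z (e b) <-> ((inl b : ordered_sum oindex 'I_1) < z)%O.
  split; last by move=> bz; apply/gE; right; exists b.
  move=> /gE [|[b' b'z]]; first by rewrite leNgt xe.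
  rewrite leNgt => h; apply: le_lt_trans b'z.
  by rewrite leNgt; apply: contra h; rewrite ordered_sum_ltl; apply: eh.
exists (g : order_topology _ -> cutspace); have gh : {homo g : x y / (x < y)%O}.
  move=> [b|i] z' zz'; last first.
    case: z' zz' => [//|j]; by rewrite (ord1_eq i j) ltxx.
  by apply/cut_ltP; exists (e b); [rewrite ge ltxx|apply/ge].
split => //.
- apply: strict_mono_embedding => //; apply: cutspace_continuous => u.
    have [ux|xu] := leP u x.
      by rewrite (_ : mkset _ = setT); [exact: openT|rewrite -subTset => z _; apply/gE; left].
    rewrite (_ : mkset _ = \bigcup_(b in [set b | u <= e b])
      `](inl b : order_topology (ordered_sum oindex 'I_1)), +oo[%classic).
      by apply: bigcup_open => b _; apply: rray_open.
    apply/seteqP; split => [z /gE [|[b bz ub]]|z [b ub]]; first by rewrite leNgt xu.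
      by exists b => //=; rewrite in_itv /= bz.
    by rewrite /= in_itv /= andbT => bz; apply/gE; right; exists b.
  have [ux|xu] := leP u x.
    by rewrite (_ : mkset _ = set0); [exact: open0|rewrite -subset0 => z; apply; apply/gE; left].
  have [[b0 ub0]|nb] := pselect (exists b, u <= e b); last first.
    rewrite (_ : mkset _ = setT); [exact: openT|rewrite -subTset => z _ /gE [|[b _ ub]]].
      by rewrite leNgt xu.
    by apply: nb; exists b.
  (* The cuts omitting [u] are those of the points [z <= b], an open ray because [b] has a
     successor. *)
  have [b ub minb] := @omega1_min _ _ oindexP [set b | u <= e b] (ex_intro _ b0 ub0).
  have [b1 bb1 b1E] := omega1_succ oindexP b.
  rewrite (_ : mkset _ = `]-oo, (inl b1 : order_topology (ordered_sum oindex 'I_1))[%classic).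
    exact: lray_open.
  apply/seteqP; split => z /=; rewrite in_itv /=.
    move=> ngz; case: z ngz => [b'|i] ngz.
      rewrite ordered_sum_ltl b1E leNgt; apply/negP => bb'.
      by apply: ngz; apply/gE; right; exists b; rewrite ?ordered_sum_ltl.
    by exfalso; apply: ngz; apply/gE; right; exists b.
  move=> zb1 /gE [|[b' b'z /minb bb']]; first by rewrite leNgt xu.
  have := lt_trans b'z zb1; rewrite ordered_sum_ltl.
  rewrite b1E => b'b; move: b'z zb1; case: z => // b2 b'b2 b2b1.
  have b2b : (b2 <= b)%O by rewrite -b1E -(ordered_sum_ltl 'I_1).
  by move: b'b2; rewrite ordered_sum_ltl => b'b2; have := lt_le_trans b'b2 b2b; rewrite ltNge bb'.
- move=> _ [z _ <-]; split; first by apply/gE; left.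
  move=> /gE [|[b _]]; first by rewrite leNgt xy.
  by rewrite leNgt ey.
Qed.

(** The mirror image: the elements [x + lexdelta v] decrease and stay below [y], and the cut of [z]
    lies below all those attached to points strictly above [z]. *)
Lemma cell_succ_omega1_rev (x y : lexgrp) : 0 <= x -> x < y -> y <= lexdelta oindex0 ->
  contains_copy (order_topology (ordered_sum 'I_1 oindex^d)) (cell x y).
Proof.
move=> x0 xy y1; have /lexltP [c d0 dc] : 0 < y - x by rewrite lex_subgt0.
have [w cw _] := omega1_succ oindexP c; have [f [fh fw _]] := omega1_final_segment oindexP w.
pose e b := x + lexdelta (f b).
have eh b b' : (b < b')%O -> e b' < e b.
  by move=> bb'; rewrite /e lex_ltD2l; apply/lexdelta_lt/fh.
have ey b : e b < y.
  rewrite /e addrC -(lex_ltD2r (- x)) addrK.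
  apply: lexdelta_lt_lead dc _; last exact: lt_le_trans (fw b).
  by move=> u /d0; rewrite lex0.
have xe b : x < e b by rewrite /e -{1}(addr0 x) lex_ltD2l lexdelta_gt0.
pose Z := ordered_sum 'I_1 oindex^d.
pose i (b : oindex) : Z := inr b.
have ilt b b' : (i b < i b')%O = (b' < b)%O by rewrite ordered_sum_ltr.
have /choice [g gE] : forall z : Z, exists A : cut, forall u,
    A u <-> u < y /\ forall b, (z < i b)%O -> u < e b.
  move=> z; have [|||A AE] := @mk_cut [set u | u < y /\ forall b, (z < i b)%O -> u < e b].
  - move=> u v vu /= [uy h]; split; first exact: le_lt_trans uy.
    by move=> b /h; apply: le_lt_trans.
  - split; first exact: le_lt_trans xy.
    by move=> b _; apply: le_lt_trans (xe b).
  - by move=> [+ _]; rewrite ltNge y1.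
  - by exists A => u; rewrite AE.
have ge (z : Z) b : g z (e b) <-> (i b <= z)%O.
  split; first by move=> /gE [_ h]; rewrite leNgt; apply/negP => /h; rewrite ltxx.
  move=> bz; apply/gE; split => // b' zb'; apply: eh; rewrite -ilt.
  exact: le_lt_trans zb'.
exists (g : order_topology _ -> cutspace); have gh : {homo g : x y / (x < y)%O}.
  move=> z [j|b] zz'.
    by case: z zz' => [k|//]; rewrite (ord1_eq j k) ltxx.
  by apply/cut_ltP; exists (e b); [rewrite ge leNgt zz'|apply/ge].
split => //.
(* Either [u] lies in every cut of the image, or the least index [b] with [e b <= u] decides which
   cuts contain it. *)
- have key u : u < y -> (forall b, u < e b) \/ exists b, forall z : Z, g z u <-> (i b <= z)%O.
    move=> uy; have [|/existsNP [b0 /negP]] := pselect (forall b, u < e b); first by left.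
    rewrite -leNgt => ub0; right.
    have [b ub minb] := @omega1_min _ _ oindexP [set b | e b <= u] (ex_intro _ b0 ub0).
    exists b => z; split.
      move=> /gE [_ h]; rewrite leNgt; apply/negP => /h; rewrite ltNge.
      by rewrite ub.
    move=> bz; apply/gE; split => // b' zb'; rewrite ltNge; apply/negP => /minb.
    by rewrite leNgt -ilt (le_lt_trans bz).
  apply: strict_mono_embedding => //; apply: cutspace_continuous => u.
    have [yu|uy] := leP y u.
      rewrite (_ : mkset _ = set0); [exact: open0|rewrite -subset0 => z /gE [+ _]].
      by rewrite ltNge yu.
    have [h|[b bE]] := key u uy.
      by rewrite (_ : mkset _ = setT); [exact: openT|rewrite -subTset => z _; apply/gE].
    have [b1 bb1 b1E] := omega1_succ oindexP b.
    rewrite (_ : mkset _ = `](i b1 : order_topology Z), +oo[%classic); first exact: rray_open.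
    apply/seteqP; split => z /=; rewrite in_itv /= andbT bE.
      by apply: lt_le_trans; rewrite ilt.
    case: z => [//|b2] h; rewrite leNgt ilt -leNgt -b1E -ilt.
    exact: h.
  have [yu|uy] := leP y u.
    rewrite (_ : mkset _ = setT); [exact: openT|rewrite -subTset => z _ /gE [+ _]].
    by rewrite ltNge yu.
  have [h|[b bE]] := key u uy.
    by rewrite (_ : mkset _ = set0); [exact: open0|rewrite -subset0 => z /=; apply; apply/gE].
  rewrite (_ : mkset _ = `]-oo, (i b : order_topology Z)[%classic); first exact: lray_open.
  apply/seteqP; split => z /=; rewrite in_itv /= bE leNgt; first by move/negP; rewrite negbK.
  by move=> ->.
- move=> _ [z _ <-]; split; first by apply/gE.
  by move=> /gE []; rewrite ltxx.
Qed.

Lemma cutspace_interval_copies (i : interval cutspace) : itv_open_ends i ->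
  [set` i] !=set0 -> contains_omega1_succ [set` i] /\ contains_succ_omega1_rev [set` i].
Proof.
move=> oi [A Ai].
have [|x [y [x0 y1 [Ax Ay] xyi]]] := @cell_nbhs A [set` i].
  by apply: open_nbhs_nbhs; split => //; apply: itv_open_ends_open.
have xy := cut_lt Ax Ay; split; exists _, oindex; split; try exact: oindexP.
- have [g [g1 g2 g3]] := cell_omega1_succ x0 xy y1.
  by exists g; split => // z /g3 /xyi.
- have [g [g1 g2 g3]] := cell_succ_omega1_rev x0 xy y1.
  by exists g; split => // z /g3 /xyi.
Qed.

(** At the image of the top of omega_1 + 1, each set of a countable base contains a tail of the
    sequence. One index [b0] lies beyond the start of all these tails, so no base set fits into the
    ray strictly above the point at [b0]. *)
Lemma cutspace_nowhere_first_countable : nowhere_first_countable cutspace.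
Proof.
move=> A fA; rewrite -subset0 => B /cell_nbhs [x [y [x0 y1 [Bx By] xyA]]].
have [g [[_ gc _] gh gA]] := cell_omega1_succ x0 (cut_lt Bx By) y1.
pose top : order_topology (ordered_sum oindex 'I_1) := inr ord0.
pose j (b : oindex) : order_topology (ordered_sum oindex 'I_1) := inl b.
have Ag z : A (g z) by apply/xyA/gA; exists z.
pose a z : set_type A := exist _ (g z) (mem_set (Ag z)).
have [Bs [cBs Bn Bb]] := fA (a top).
have hb (V : set (set_type A)) : exists b, Bs V -> forall b', (b < b')%O -> V (a (j b')).
  have [BV|nBV] := pselect (Bs V); last by exists oindex0.
  have [_ [[W oW <-] Wa WV]] := Bn _ BV.
  have /order_nbhs_option [l [r [ll rr lrW]]] : nbhs top (g @^-1` W).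
    by apply: gc; apply: open_nbhs_nbhs.
  have rN : r = None by case: r rr {lrW} => // -[b|k] /(_ _ erefl) //; rewrite (ord1_eq k ord0) ltxx.
  case: l ll lrW => [[b|k] /(_ _ erefl)|_] //.
  - move=> _ lrW; exists b => _ b' bb'; apply: WV; apply: lrW; rewrite ?rN //.
    by move=> _ [<-]; rewrite /j ordered_sum_ltl.
  - by rewrite (ord1_eq k ord0) ltxx.
  - by move=> lrW; exists oindex0 => _ b' _; apply: WV; apply: lrW; rewrite ?rN.
have {hb} /choice [b bP] := hb.
have [b0 b0P] := omega1_bounded oindexP (countable_img b cBs).
have [|V BV VU] := Bb [set z | (g (j b0) < val z)%O].
  exists [set z | (g (j b0) < val z)%O]; split => //=; last exact: gh.
  exists `](g (j b0)), +oo[%classic; first exact: rray_open.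
  by apply/seteqP; split => z /=; rewrite in_itv /= andbT.
have : V (a (j b0)) by apply: bP => //; apply: b0P; exists V.
by move=> /VU /=; rewrite ltxx.
Qed.

(** * Valdivia embedding of the space of cuts *)

Lemma ptws_cvgP (I : Type) (V : topologicalType) (F : set_system (I -> V))
    (f : {ptws I -> V}) : Filter F ->
  (F --> f) <-> forall i, (fun g : I -> V => g i) @ F --> f i.
Proof.
move=> FF; rewrite cvg_sup; split => h i; move: (h i).
  rewrite cvg_image; last by rewrite eqEsubset; split=> v // _; exists (cst v).
  apply: cvg_trans => W /=; rewrite ?nbhs_simpl /fmap /= => [[W' + <-]].
  by apply: filterS => g W'g /=; exists g.
rewrite cvg_image; last by rewrite eqEsubset; split=> v // _; exists (cst v).
move=> + W //=; rewrite ?nbhs_simpl => Q => /Q Q'; exists (@^~ i @^-1` W) => //.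
by rewrite eqEsubset; split => [j [? + <-//]|j Wj]; exists (fun _ => j).
Qed.

Lemma ptws_proj_continuous (I : Type) (V : topologicalType) (i : I) :
  continuous (fun g : {ptws I -> V} => g i).
Proof.
by move=> f; apply: (ptws_cvgP f (nbhs_filter f)).1; apply: cvg_id.
Qed.

Lemma ptws_continuous (I : Type) (X V : topologicalType) (h : X -> {ptws I -> V}) :
  (forall i, continuous (fun x => h x i)) -> continuous h.
Proof. by move=> hc x; apply/ptws_cvgP => i; apply: hc. Qed.

Lemma ptws_hausdorff (I : Type) (V : topologicalType) :
  hausdorff_space V -> hausdorff_space {ptws I -> V}.
Proof. by move=> hV; apply: (@hausdorff_product {classic I} (fun=> V)). Qed.

Lemma continuous_compact_closed_image (X Y : topologicalType) (h : X -> Y) (C : set X) :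
  compact [set: X] -> hausdorff_space Y -> continuous h -> closed C ->
  closed (h @` C).
Proof.
move=> cX hY hc cC; apply: compact_closed => //; apply: continuous_compact.
  exact: continuous_subspaceT.
exact: subclosed_compact cX _.
Qed.

Lemma compact_embedding (X Y : topologicalType) (h : X -> Y) :
  compact [set: X] -> hausdorff_space Y -> continuous h -> injective h ->
  topological_embedding h.
Proof.
move=> cX hY hc hi; split => // U oU; exists (~` (h @` (~` U))).
  rewrite openC; apply: continuous_compact_closed_image => //.
  by rewrite closedC.
apply/seteqP; split => x.
  by move=> Ux [y nUy /hi xy]; apply: nUy; rewrite xy.
by move=> h1; apply: contrapT => nUx; apply: h1; exists x.
Qed.

Definition lex_last (g : lexgrp) (m : oindex) :=
  g m != 0 /\ forall u, (m < u)%O -> g u = 0.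

Lemma lex_lastP (g : lexgrp) : g <> 0 -> exists m, lex_last g m.
Proof.
move=> g0; have /finite_seqP [s sE] := lexgrp_fin g.
have [v gv] : exists v, g v != 0.
  apply: contrapT => /forallNP h; apply: g0; apply: lexgrpP => v.
  by apply: contrapT => /eqP; apply: h.
have vs : v \in s by have : [set` s] v by rewrite -sE.
have [m ms mmax] : exists2 m, m \in s & forall u, u \in s -> (u <= m)%O.
  move: vs; elim: s {sE gv} v => [//|a s IH] v _.
  have [/eqP ->|sn] := boolP (s == [::]).
    by exists a; rewrite ?inE // => u; rewrite inE => /eqP ->.
  have [b bs] : exists b, b \in s by case: s sn {IH} => // b s _; exists b; rewrite mem_head.
  have [m ms mmax] := IH b bs; have [am|ma] := leP a m.
    by exists m => [|u]; rewrite inE ?ms ?orbT // => /orP[/eqP ->|/mmax].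
  exists a => [|u]; rewrite inE ?eqxx // => /orP[/eqP ->|/mmax] //.
  by move/le_trans; apply; apply: ltW.
exists m; split; first by have : [set` s] m := ms; rewrite -sE.
move=> u mu; apply: contrapT => /eqP gu.
have us : u \in s by have : [set` s] u by rewrite -sE.
by move: mu; rewrite ltNge mmax.
Qed.

Lemma lex_trunc_exists (w : oindex) (g : lexgrp) :
  exists t : lexgrp, forall v, t v = if (v < w)%O then g v else 0.
Proof.
have [|t tE] := @mk_lexgrp (fun v => if (v < w)%O then g v else 0).
  apply: sub_finite_set (lexgrp_fin g) => v /=.
  by case: ifP => // _; rewrite eqxx.
by exists t => v; rewrite tE.
Qed.

Definition lex_trunc w g := sval (cid (lex_trunc_exists w g)).

Lemma lex_truncE w g v : lex_trunc w g v = if (v < w)%O then g v else 0.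
Proof. exact: (svalP (cid (lex_trunc_exists w g))). Qed.

Lemma lex_trunc_le w : {homo lex_trunc w : x y / x <= y}.
Proof.
move=> x y; rewrite le_eqVlt => /orP[/eqP ->//|/lexltP [v xyv ltv]].
have [vw|wv] := ltP v w.
  apply: ltW; apply/lexltP; exists v => [u uv|]; rewrite !lex_truncE.
    by rewrite (lt_trans uv vw) xyv.
  by rewrite vw.
rewrite le_eqVlt; apply/orP; left; apply/eqP; apply: lexgrpP => u.
rewrite !lex_truncE; case: ltP => // uw; apply: xyv.
exact: lt_le_trans wv.
Qed.

Lemma lex_trunc_id w (g : lexgrp) : (forall v, g v != 0 -> (v < w)%O) -> lex_trunc w g = g.
Proof.
move=> gw; apply: lexgrpP => v; rewrite lex_truncE; case: ifP => // /negbT vw.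
by apply/esym/eqP; apply: contraNT vw; apply: gw.
Qed.

Lemma lex_trunc_trunc w m g : (w <= m)%O -> lex_trunc w (lex_trunc m g) = lex_trunc w g.
Proof.
move=> wm; apply: lexgrpP => v; rewrite !lex_truncE; case: ifP => // vw.
by rewrite (lt_le_trans vw wm).
Qed.

(** The condition is vacuous at [0], whose parent stays unspecified; cuts agree at [0] anyway. *)
Lemma lex_parent_exists (g : lexgrp) : exists p : lexgrp,
  forall m, lex_last g m -> p = lex_trunc m g.
Proof.
have [->|/eqP g0] := eqVneq g 0.
  by exists 0 => m []; rewrite lex0 eqxx.
have [m [gm mm]] := lex_lastP g0; exists (lex_trunc m g) => m' [gm' mm'].
have -> // : m = m'; case: (ltgtP m m') => // [/mm|/mm'] h.
  by rewrite h eqxx in gm'.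
by rewrite h eqxx in gm.
Qed.

Definition lex_parent g := sval (cid (lex_parent_exists g)).

Lemma lex_parentP g m : lex_last g m -> lex_parent g = lex_trunc m g.
Proof. exact: (svalP (cid (lex_parent_exists g)) m). Qed.

(** The graph over its support codes such an element as a finite subset of a countable set. *)
Lemma lex_bounded_countable (w : oindex) :
  countable [set g : lexgrp | forall v, g v != 0 -> (v < w)%O].
Proof.
pose f (g : lexgrp) := [set p : oindex * rat | g p.1 != 0 /\ p.2 = g p.1].
pose D := [set v : oindex | (v < w)%O] `*` [set: rat].
have cD : countable D.
  have cw : countable [set v : oindex | (v < w)%O] by case: oindexP.
  by apply: countableX cw _; apply: countableP.
apply: (@countable_inj_preimage _ _ f _ _ _ _ (countable_finite_subset cD)) => [x y xy|g gw].
  have fP (z : lexgrp) v q : f z (v, q) <-> z v != 0 /\ q = z v by [].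
  apply: lexgrpP => v; have [xv|xv] := eqVneq (x v) 0.
    apply: contrapT => yv; have : f y (v, y v).
      by split => //=; apply/eqP => yv0; apply: yv; rewrite xv yv0.
    by rewrite -xy => -[/=]; rewrite xv eqxx.
  have : f x (v, x v) by [].
  by rewrite xy => -[].
split; first by move=> [v q] /= [/gw].
apply: (@sub_finite_set _ _ ((fun v => (v, g v)) @` [set v | g v != 0])).
  by move=> [v q] [/= gv ->]; exists v.
by apply: finite_image; apply: lexgrp_fin.
Qed.

(* The coordinate at [g] records whether a cut separates [g] from its parent
   (drop the last basis vector of [g]); pulling a cut back along a truncation
   gives a point with countably many nonzero coordinates. *)
Lemma cutspace_valdivia (R : realType) : valdivia_compact R cutspace.
Proof.
split; first exact: cutspace_compact.
pose sep (A : cut) g := ~ (A g <-> A (lex_parent g)).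
pose h (A : cutspace) : {ptws lexgrp -> R} := fun g => if `[< sep A g >] then 1 else 0.
have h01 A g : h A g = 0 <-> ~ sep A g.
  rewrite /h; case: asboolP => s; split => // /eqP.
  by rewrite oner_eq0.
have hc : continuous h.
  apply: ptws_continuous => g A; pose p := lex_parent g.
  have : nbhs A [set B : cutspace | h B g = h A g].
    have near1 u : nbhs A [set B : cutspace | (B : cut) u <-> (A : cut) u].
      have [Au|nAu] := pselect ((A : cut) u).
        apply: filterS (open_nbhs_nbhs (conj (cut_mem_open u) Au)) => B Bu.
        by split.
      apply: filterS (open_nbhs_nbhs (conj (cut_nmem_open u) nAu)) => B nBu.
      by split.
    apply: filterS2 (near1 g) (near1 p) => B [B1 B2] [B3 B4].
    have BA : (B : cut) g = (A : cut) g by apply/propext.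
    have BAp : (B : cut) p = (A : cut) p by apply/propext.
    by rewrite /= /h /sep BA BAp.
  move=> nA U hU; apply: filterS nA => B /= ->; exact: nbhs_singleton.
have hi : injective h.
  move=> A B hAB; have eqsep g : sep A g <-> sep B g.
    have := congr1 (fun z : {ptws lexgrp -> R} => z g) hAB; rewrite /h.
    by do 2 case: asboolP => // ?; move/eqP; rewrite ?oner_eq0 // eq_sym oner_eq0.
  (* The coordinate at [g] together with membership of its parent decides membership of [g], and a
     nonzero parent has an earlier last index. *)
  suff key m : forall g : lexgrp, (forall u, g u != 0 -> (u <= m)%O) -> A g <-> B g.
    apply: cutP => g; have [->|/eqP g0] := eqVneq g 0.
      by split => _; apply: cut0.
    have [m [_ gm]] := lex_lastP g0; apply: (key m) => u; apply: contraNT.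
    by rewrite -ltNge => /gm ->.
  elim/(well_founded_ind (omega1_wf oindexP)): m => m IH g gm.
  have [->|/eqP g0] := eqVneq g 0; first by split => _; apply: cut0.
  have [l gl] := lex_lastP g0.
  have par : A (lex_parent g) <-> B (lex_parent g).
    have [->|/eqP p0] := eqVneq (lex_parent g) 0; first by split => _; apply: cut0.
    have [l' [pl' pl'm]] := lex_lastP p0.
    have l'l : (l' < l)%O.
      by move: pl'; rewrite (lex_parentP gl) lex_truncE; case: ifP => // _; rewrite eqxx.
    apply: (IH l'); first by apply: lt_le_trans l'l _; apply: gm; case: gl.
    by move=> u; apply: contraNT; rewrite -ltNge => /pl'm ->.
  have := eqsep g; rewrite /sep => -[e1 e2].
  have [sA|nsA] := pselect (A g <-> A (lex_parent g)).
    have sB : B g <-> B (lex_parent g) by apply: contrapT => /e2.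
    by split => [/sA/par/sB|/sB/par/sA].
  have nsB := e1 nsA.
  have [Ap|nAp] := pselect (A (lex_parent g)).
    have Bp := par.1 Ap.
    by split => H; exfalso; [apply: nsA|apply: nsB].
  have nBp : ~ B (lex_parent g) by move=> /par.
  have [Ag|nAg] := pselect (A g); last by exfalso; apply: nsA.
  split => // _; apply: contrapT => nBg; apply: nsB; split => //.
have hR : hausdorff_space {ptws lexgrp -> R}.
  by apply: ptws_hausdorff; apply: Rhausdorff.
exists lexgrp, h; split.
- exact: compact_embedding cutspace_compact hR hc hi.
- move=> _ [A _ <-] g; rewrite /h; case: ifP => _; rewrite ?lexx ?ler01 //.
- apply/seteqP; split; last first.
    rewrite [X in _ `<=` X](closure_id _).1.
      by apply: closure_subset; apply: subIsetl.
    by apply: continuous_compact_closed_image => //; exact: cutspace_compact.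
  move=> _ [A _ <-] V hV; have /cell_nbhs [x [y [x0 y1 [Ax nAy] xyV]]] := hc A _ hV.
  have cx (z : lexgrp) : countable [set v | z v != 0].
    by apply: finite_set_countable; apply: lexgrp_fin.
  (* Truncation at [w] fixes [x], [y] and the upper end, so the cut pulled back along it stays in
     the cell. *)
  have [w wP] := omega1_bounded oindexP
    (countableU (cx (lexdelta oindex0)) (countableU (cx x) (cx y))).
  have tE (z : lexgrp) : [set v | z v != 0] `<=` [set v | (v < w)%O] -> lex_trunc w z = z.
    by move=> h1; apply: lex_trunc_id.
  have te : lex_trunc w (lexdelta oindex0) = lexdelta oindex0.
    by apply: tE => v hv; apply: wP; left.
  have [|||B BE] := @mk_cut [set g | A (lex_trunc w g)].
  - by move=> u v vu /=; apply: cut_down; apply: lex_trunc_le.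
  - by rewrite /= (lex_trunc_id (g := 0)) => [|v]; [exact: cut0|rewrite lex0 eqxx].
  - by rewrite /= te; apply: cut1.
  have Bm g : B g = A (lex_trunc w g) by rewrite BE.
  exists (h B); split; last first.
    apply: xyV; split; rewrite Bm tE // => v hv; apply: wP; right; [by left|by right].
  split; first by exists B.
  split; first by move=> g; rewrite /h; case: ifP => _; rewrite ?lexx ?ler01.
  (* If the support of [g] reaches [w], then [g] and its parent differ only at an index that
     truncation erases, and [B] does not separate them. *)
  apply: countableS (lex_bounded_countable w) => g /= hg v gv.
  rewrite ltNge; apply/negP => wv; move: hg => /eqP; apply; apply/h01; apply.
  have g0 : g <> 0 by move=> g0; rewrite g0 lex0 eqxx in gv.
  have [m gm] := lex_lastP g0; rewrite !Bm (lex_parentP gm) lex_trunc_trunc //.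
  apply: le_trans wv _; rewrite leNgt; apply/negP => /(gm.2 v) gv0.
  by rewrite gv0 eqxx in gv.
Qed.

(** * Boxes and good coordinate sets *)

Section Directed.
Context {d : Order.disp_t} {X : orderTopologicalType d}.
Implicit Types (b : bool) (x y z : X).

(* The order of [X] or its converse, so that one argument serves both sides. *)
Definition dle b x y : bool := if b then (x <= y)%O else (y <= x)%O.

Lemma dle_refl b x : dle b x x. Proof. by case: b => /=. Qed.

Lemma dle_trans b : transitive (dle b).
Proof. by case: b => y x z /= xy yz; [apply: le_trans xy yz|apply: le_trans yz xy]. Qed.

Lemma dle_total b x y : dle b x y \/ dle b y x.
Proof. by case: b => /=; apply/orP; apply: le_total. Qed.

Lemma dle_anti b x y : dle b x y -> dle b y x -> x = y.
Proof. by case: b => /= xy yx; apply/le_anti; rewrite xy yx. Qed.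

Lemma dle_open b x : open [set y | ~~ dle b x y].
Proof.
case: b => /=.
  rewrite (_ : mkset _ = `]-oo, x[%classic); first exact: lray_open.
  by apply/seteqP; split => y /=; rewrite in_itv /= ltNge.
rewrite (_ : mkset _ = `]x, +oo[%classic); first exact: rray_open.
by apply/seteqP; split => y /=; rewrite in_itv /= andbT ltNge.
Qed.

Lemma dle_openC b x : open [set y | ~~ dle b y x].
Proof. by have := dle_open (~~ b) x; case: b. Qed.

Lemma dleN b x y : ~~ dle b x y -> dle b y x.
Proof. by case: (dle_total b x y) => [->|]. Qed.

Lemma dle_neq x y : x <> y -> exists b, ~~ dle b y x.
Proof.
move=> xy; case: (ltgtP x y) => // h; [exists true|exists false]; rewrite /= -ltNge //.
Qed.

End Directed.

Section Boxes.
Context {I : Type} {R : realType}.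
Notation box := (seq (I * (rat * rat))).
Implicit Types (s t : box) (S : set I) (z : I -> R).

(** Basic open boxes are finite lists of coordinates with rational bounds, so countably many
    coordinates carry only countably many boxes. *)
Fixpoint inbox s z : Prop :=
  if s is b :: s' then (ratr b.2.1 < z b.1 /\ z b.1 < ratr b.2.2) /\ inbox s' z else True.

Fixpoint over S s : Prop := if s is b :: s' then S b.1 /\ over S s' else True.

Fixpoint restr S s : box :=
  if s is b :: s' then (if `[< S b.1 >] then b :: restr S s' else restr S s') else [::].

Lemma inbox_cat s t z : inbox (s ++ t) z <-> inbox s z /\ inbox t z.
Proof. by elim: s => [|b s IH] /=; [tauto|rewrite IH; tauto]. Qed.

Lemma inbox_ext S s z z' : over S s -> (forall i, S i -> z i = z' i) ->
  inbox s z -> inbox s z'.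
Proof.
move=> + zz'; elim: s => [//|b s IH] /= [Sb /IH {}IH] [h /IH {}IH].
by rewrite -zz'.
Qed.

Lemma over_restr S s : over S (restr S s).
Proof. by elim: s => [//|b s IH] /=; case: asboolP. Qed.

Lemma inbox_restr S s z : inbox s z -> inbox (restr S s) z.
Proof. by elim: s => [//|b s IH] /= [h /IH {}IH]; case: asboolP. Qed.

Lemma inbox_restrP S s z w z' : inbox (restr S s) z -> inbox s w ->
  (forall i, S i -> z' i = z i) -> (forall i, ~ S i -> z' i = w i) -> inbox s z'.
Proof.
move=> + + h1 h2; elim: s => [//|b s IH] /=; case: asboolP => Sb /=.
  by move=> [hb hs] [_ hw]; rewrite h1 //; split => //; apply: IH.
by move=> hs [hb hw]; rewrite h2 //; split => //; apply: IH.
Qed.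

Lemma over_sub S S' s : S `<=` S' -> over S s -> over S' s.
Proof. by move=> SS'; elim: s => [//|b s IH] /= [/SS' ? /IH]. Qed.

Lemma over_countable S : countable S -> countable [set s | over S s].
Proof.
move=> /countable_injP [f fi].
pose g s := [seq (f b.1, b.2) | b <- s].
apply/countable_injP; exists (fun s => pickle (g s)) => s t /set_mem os /set_mem ot.
move=> /(pcan_inj pickleK); elim: s t os ot => [|b s IH] [|c t] //= [Sb os] [Sc ot] [/fi fbc e /IH ->] //.
congr (_ :: _); case: b c Sb Sc fbc e => [b1 b2] [c1 c2] /= Sb Sc fbc ->.
by rewrite fbc // inE.
Qed.

Lemma over_chain (D : Type) (P : set D) (S : D -> set I) s :
  P !=set0 -> (forall a b, P a -> P b -> exists c, [/\ P c, S a `<=` S c & S b `<=` S c]) ->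
  over (\bigcup_(a in P) S a) s -> exists2 a, P a & over (S a) s.
Proof.
move=> [a0 Pa0] ch; elim: s => [|b s IH] /=; first by exists a0.
move=> [[a Pa Sab] /IH [a' Pa' os]]; have [c [Pc ac a'c]] := ch _ _ Pa Pa'.
by exists c => //; split; [apply: ac|apply: over_sub os].
Qed.

Lemma box_nbhs (z : {ptws I -> R}) (V : set {ptws I -> R}) : nbhs z V ->
  exists2 s, inbox s z & forall w, inbox s w -> V w.
Proof.
pose F := filter_from [set s | inbox s z] (fun s => [set w : I -> R | inbox s w]).
have FF : Filter F.
  apply: filter_from_filter; first by exists [::].
  move=> s t sz tz; exists (s ++ t); first by apply/inbox_cat.
  by move=> w /inbox_cat.
suff : F --> z by move=> Fz /Fz [s sz sV]; exists s => // w /sV.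
apply/(ptws_cvgP z FF) => i W /nbhs_ballP [e /= e0 eW].
have [a] : exists a : rat, ratr a \in `](z i - e), (z i)[.
  by apply: rat_in_itvoo; rewrite ltrBlDr ltrDl.
rewrite in_itv /= => /andP[a1 a2].
have [b] : exists b : rat, ratr b \in `](z i), (z i + e)[.
  by apply: rat_in_itvoo; rewrite ltrDl.
rewrite in_itv /= => /andP[b1 b2].
exists [:: (i, (a, b))] => //= w /= [[aw wb] _]; apply: eW.
by rewrite /ball /= ltr_distlC (lt_trans a1 aw) (lt_trans wb b2).
Qed.

Lemma box_open (X : topologicalType) (h : X -> {ptws I -> R}) s :
  continuous h -> open [set x | inbox s (h x)].
Proof.
move=> hc; elim: s => [|b s IH].
  by rewrite (_ : mkset _ = setT); [exact: openT|rewrite -subTset].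
apply: openI IH.
have hbc : continuous (fun x => (h x : I -> R) b.1).
  by move=> x; exact: (continuous_comp (hc x) (@ptws_proj_continuous I R b.1 (h x))).
rewrite (_ : (fun x => _) = (fun x => (h x : I -> R) b.1) @^-1` `](ratr b.2.1), (ratr b.2.2)[%classic).
  by apply: open_comp => [x _|]; [exact: hbc|exact: interval_open].
apply/seteqP; split => x /=; rewrite in_itv /=; first by move=> [-> ->].
by move=> /andP.
Qed.

(** A closing-off argument in omega steps, as for countable elementary submodels. *)
Lemma countable_hull (Phi : box -> box -> set I) (S0 : set I) :
  (forall s t, countable (Phi s t)) -> countable S0 ->
  exists S, [/\ countable S, S0 `<=` S &
    forall s t, over S s -> over S t -> Phi s t `<=` S].
Proof.
move=> cPhi cS0.
pose step S := S `|` \bigcup_(p in [set s | over S s] `*` [set s | over S s]) Phi p.1 p.2.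
pose Sn n := iter n step S0.
have cSn n : countable (Sn n).
  elim: n => [//|n IH]; apply: countableU => //; apply: bigcup_countable => //.
  by apply: countableX; apply: over_countable.
have mon m n : (m <= n)%N -> Sn m `<=` Sn n.
  move=> /subnK <-; elim: (n - m)%N => [//|k IH] i /IH hi.
  by left.
exists (\bigcup_(n in setT) Sn n); split.
- by apply: bigcup_countable => //; apply: countableP.
- by move=> i S0i; exists 0%N.
- move=> s t os ot i Pi.
  have ch (a b : nat) : setT a -> setT b ->
      exists c, [/\ setT c, Sn a `<=` Sn c & Sn b `<=` Sn c].
    by move=> _ _; exists (maxn a b); split => //; apply: mon; rewrite ?leq_maxl ?leq_maxr.
  have ne : [set: nat] !=set0 by exists 0%N.
  have [n _ osn] := over_chain ne ch os; have [m _ otm] := over_chain ne ch ot.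
  exists (maxn n m).+1 => //; right; exists (s, t) => //.
  by split; [apply: over_sub osn|apply: over_sub otm]; apply: mon; rewrite ?leq_maxl ?leq_maxr.
Qed.

End Boxes.

(** * Retractions given by good coordinate sets *)

Section GoodSets.
Context {R : realType} {d : Order.disp_t} {X : orderTopologicalType d}.
Context {I : Type} (h : X -> {ptws I -> R}).
Hypothesis h_embedding : topological_embedding h.
Hypothesis h_valdivia : range h = closure (range h `&` @sigma_product R I).
Notation box := (seq (I * (rat * rat))).
Implicit Types (s t : box) (S T : set I) (x y z p : X).

Definition supp x : set I := [set i | h x i != 0].

Definition agree S x y : Prop := forall i, S i -> h x i = h y i.

Lemma box_openX s : open [set x | inbox s (h x)].
Proof. by apply: box_open; case: h_embedding. Qed.

Lemma box_nbhsX x (U : set X) : nbhs x U ->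
  exists2 s, inbox s (h x) & forall y, inbox s (h y) -> U y.
Proof.
rewrite nbhsE => -[W [oW Wx] WU]; case: h_embedding => _ _ /(_ W oW) [V oV WV].
have [|s sx sV] := @box_nbhs I R (h x) V.
  by apply: open_nbhs_nbhs; split => //; move: Wx; rewrite WV.
by exists s => // y /sV hy; apply: WU; rewrite WV.
Qed.

Lemma sigma_dense (U : set X) x : open U -> U x -> exists2 y, U y & countable (supp y).
Proof.
move=> oU Ux; case: h_embedding => hi _ /(_ U oU) [V oV UV].
have : range h (h x) by exists x.
rewrite h_valdivia => /(_ V) [|_ [[[y _ <-] [_ cy]] Vy]].
  by apply: open_nbhs_nbhs; split => //; move: Ux; rewrite UV.
by exists y => //; rewrite UV.
Qed.

Lemma range_box_closed (z : I -> R) : (forall s, inbox s z -> exists x, inbox s (h x)) ->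
  exists x, h x = z.
Proof.
move=> hz; have : range h z.
  have cl : closed (range h) by rewrite h_valdivia; apply: closed_closure.
  apply: cl => V /box_nbhs [s /hz [x sx] sV].
  by exists (h x); split; [exists x|apply: sV].
by case=> x _ <-; exists x.
Qed.

(** A reflection property. Its case [s = t] provides enough points supported on [S] for the
    retraction to exist; ordered pairs make it monotone. *)
Definition good S : Prop := forall s t, over S s -> over S t ->
  (exists x y, [/\ (x <= y)%O, inbox s (h x) & inbox t (h y)]) ->
  exists x y, [/\ (x <= y)%O, inbox s (h x), inbox t (h y), supp x `<=` S & supp y `<=` S].

Definition retr S x : X :=
  xget x [set p | agree S p x /\ supp p `<=` S].

Lemma supp0 S x i : supp x `<=` S -> ~ S i -> h x i = 0.
Proof. by move=> xS nSi; apply: contrapT => /eqP /xS. Qed.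

Lemma supp_agree S x y : supp x `<=` S -> supp y `<=` S -> agree S x y -> x = y.
Proof.
move=> xS yS xy; case: h_embedding => hi _ _; apply: hi; apply/funext => i.
by have [/xy //|nSi] := pselect (S i); rewrite !(@supp0 S).
Qed.

(** Points supported on [S] approximate the restriction of [h x] extended by zero, and the image of
    [X] is closed. *)
Lemma retrP S x : good S -> agree S (retr S x) x /\ supp (retr S x) `<=` S.
Proof.
move=> gS; rewrite /retr; case: xgetP => [p -> //|/(_ _) none]; exfalso.
have [z hz] : exists z, h z = (fun i => if `[< S i >] then h x i else 0).
  apply: range_box_closed => s sz.
  have sx : inbox (restr S s) (h x).
    apply: inbox_ext (inbox_restr S sz); first exact: over_restr.
    by move=> i Si; rewrite asboolT.
  have [|y [_ [_ sy _ yS _]]] := gS _ _ (over_restr S s) (over_restr S s).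
    by exists x, x; rewrite lexx.
  exists y; apply: inbox_restrP sy sz _ _ => // i nSi.
  by rewrite asboolF // (@supp0 S).
apply: (none z); split => i.
  by move=> Si; rewrite hz asboolT.
by rewrite /supp /= hz; case: asboolP => //; rewrite eqxx.
Qed.

Lemma retr_agree S x : good S -> agree S (retr S x) x.
Proof. by move=> gS; case: (retrP x gS). Qed.

Lemma supp_retr S x : good S -> supp (retr S x) `<=` S.
Proof. by move=> gS; case: (retrP x gS). Qed.

Lemma retr_eq S x y : good S -> agree S x y -> retr S x = retr S y.
Proof.
move=> gS xy; apply: (@supp_agree S); try exact: supp_retr.
by move=> i Si; rewrite !retr_agree // xy.
Qed.

Lemma eq_retr S x y : good S -> retr S x = retr S y -> agree S x y.
Proof. by move=> gS xy i Si; rewrite -(retr_agree x gS Si) xy retr_agree. Qed.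

Lemma retr_id S x : good S -> supp x `<=` S -> retr S x = x.
Proof.
by move=> gS xS; apply: (@supp_agree S) => //; [exact: supp_retr|exact: retr_agree].
Qed.

Lemma retr_retr S x : good S -> retr S (retr S x) = retr S x.
Proof. by move=> gS; apply: retr_id => //; apply: supp_retr. Qed.

Lemma retr_sub S T x : good S -> good T -> S `<=` T ->
  retr S (retr T x) = retr S x /\ retr T (retr S x) = retr S x.
Proof.
move=> gS gT ST; split; first by apply: retr_eq => // i /ST; apply: retr_agree.
by apply: retr_id => // i /(supp_retr gS) /ST.
Qed.

Lemma inbox_retr S s x w : good S -> inbox (restr S s) (h w) -> inbox s (h (retr S x)) ->
  inbox s (h (retr S w)).
Proof.
move=> gS sw sx; apply: inbox_restrP sw sx _ _ => i Si; first exact: retr_agree.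
by rewrite !(@supp0 S) //; apply: supp_retr.
Qed.

(** Continuity of the retraction, witnessed by a box over [S] only: off [S] all retracts vanish, so
    the bounds there carry over from [retr S x]. *)
Lemma retr_box S x (U : set X) : good S -> open U -> U (retr S x) ->
  exists s, [/\ over S s, inbox s (h x) & forall w, inbox s (h w) -> U (retr S w)].
Proof.
move=> gS oU Ux; have [s sx sU] := box_nbhsX (open_nbhs_nbhs (conj oU Ux)).
exists (restr S s); split; first exact: over_restr.
  apply: inbox_ext (inbox_restr S sx); first exact: over_restr.
  exact: retr_agree.
by move=> w sw; apply: sU; apply: inbox_retr sx.
Qed.

(* If a retraction reversed [x < y], boxes around the images would be met by
   points [x' <= y'] supported on [S], which the retraction fixes. *)
Lemma retr_homo S : good S -> {homo retr S : x y / (x <= y)%O}.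
Proof.
move=> gS x y xy; rewrite leNgt; apply/negP => yx.
have [U [V [oU oV Uy Vx UV]]] : exists U V : set X, [/\ open U, open V,
    U (retr S y), V (retr S x) & forall u v, U u -> V v -> (u < v)%O].
  have [[c /andP[c1 c2]]|nc] := pselect (exists c, (retr S y < c < retr S x)%O).
    exists `]-oo, c[%classic, `]c, +oo[%classic; split.
    - exact: lray_open.
    - exact: rray_open.
    - by rewrite /= in_itv.
    - by rewrite /= in_itv /= andbT.
    - by move=> u v; rewrite /= !in_itv /= andbT; apply: lt_trans.
  exists `]-oo, retr S x[%classic, `](retr S y), +oo[%classic; split.
  - exact: lray_open.
  - exact: rray_open.
  - by rewrite /= in_itv.
  - by rewrite /= in_itv /= andbT.
  - move=> u v; rewrite /= !in_itv /= andbT => ux yv; rewrite ltNge; apply/negP => vu.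
    by apply: nc; exists v; rewrite yv (le_lt_trans vu).
have [s [oS sx sV]] := retr_box gS oV Vx; have [t [oT ty tU]] := retr_box gS oU Uy.
have [|x' [y' [xy' sx' ty' x'S y'S]]] := gS s t oS oT; first by exists x, y.
by have := UV _ _ (tU _ ty') (sV _ sx'); rewrite !retr_id // ltNge xy'.
Qed.

Lemma retr_dle b S x y : good S -> dle b x y -> dle b (retr S x) (retr S y).
Proof. by case: b => /= gS; apply: retr_homo. Qed.

(** An initial segment for [b = true], a final segment for [b = false]. *)
Definition down_box b s : set X := [set w | exists2 v, inbox s (h v) & dle b w v].

(* A retraction moving [w0] strictly to [p] forces [p] to be isolated on that
   side in the image, so the fibre over [p] ends at the edge of a box over [T]. *)
Lemma edge_box b T y w0 : good T -> ~~ dle b w0 (retr T y) -> retr T w0 = retr T y ->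
  exists2 s, over T s & down_box b s = [set w | dle b (retr T w) (retr T y)].
Proof.
move=> gT pw0 rw0.
have [s [oS sy sU]] := @retr_box T y [set z | ~~ dle b w0 z] gT (dle_open b w0) pw0.
have sle w : inbox s (h w) -> dle b (retr T w) (retr T y).
  move=> /sU /= nle; have [//|le] := dle_total b (retr T w) (retr T y).
  have := retr_dle gT (dleN nle); rewrite retr_retr // rw0.
  by move=> /dle_anti /(_ le) ->; apply: dle_refl.
exists s => //; apply/seteqP; split => w /=.
  by move=> [v /sle le wv]; apply: dle_trans le; apply: retr_dle.
move=> le; have [wy|yw] := dle_total b w y; first by exists y.
exists w; last exact: dle_refl.
apply: inbox_ext oS _ sy; apply: eq_retr => //.
by apply: (@dle_anti _ _ b) => //; apply: retr_dle.
Qed.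

(** Sigma-points are dense in open sets, and [x < y] have neighbourhoods that keep this order: rays
    from a point in between or, at a jump, from [x] and [y] themselves. *)
Lemma sigma_pair s t : (exists x y, [/\ (x <= y)%O, inbox s (h x) & inbox t (h y)]) ->
  exists x y, [/\ (x <= y)%O, inbox s (h x), inbox t (h y), countable (supp x) & countable (supp y)].
Proof.
move=> [x [y [xy sx ty]]]; move: xy; rewrite le_eqVlt => /orP[/eqP xy|xy].
  subst y; have [z [sz tz] cz] := sigma_dense (openI (box_openX s) (box_openX t)) (conj sx ty).
  by exists z, z; split.
have [[c /andP[c1 c2]]|nc] := pselect (exists c, (x < c < y)%O).
  have [||x' [sx' x'c] cx'] := @sigma_dense ([set w | inbox s (h w)] `&` `]-oo, c[%classic) x.
  - exact: openI (box_openX s) (lray_open _).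
  - by split; rewrite //= in_itv.
  have [||y' [ty' cy'] cy''] := @sigma_dense ([set w | inbox t (h w)] `&` `]c, +oo[%classic) y.
  - exact: openI (box_openX t) (rray_open _).
  - by split; rewrite //= in_itv /= c2.
  exists x', y'; split => //; move: x'c cy'; rewrite /= !in_itv /= andbT => x'c cy'.
  exact: ltW (lt_trans x'c cy').
have [||x' [sx' x'c] cx'] := @sigma_dense ([set w | inbox s (h w)] `&` `]-oo, y[%classic) x.
- exact: openI (box_openX s) (lray_open _).
- by split; rewrite //= in_itv.
have [||y' [ty' cy'] cy''] := @sigma_dense ([set w | inbox t (h w)] `&` `]x, +oo[%classic) y.
- exact: openI (box_openX t) (rray_open _).
- by split; rewrite //= in_itv /= xy.
exists x', y'; split => //; move: x'c cy'; rewrite /= !in_itv /= andbT => x'c cy'.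
by rewrite leNgt; apply/negP => y'x'; apply: nc; exists x'; rewrite (lt_trans cy') .
Qed.

Definition pair_supp s t : set I := xget set0 [set C | countable C /\
  ((exists x y, [/\ (x <= y)%O, inbox s (h x) & inbox t (h y)]) ->
   exists x y, [/\ (x <= y)%O, inbox s (h x), inbox t (h y), supp x `<=` C & supp y `<=` C])].

Lemma pair_suppP s t : countable (pair_supp s t) /\
  ((exists x y, [/\ (x <= y)%O, inbox s (h x) & inbox t (h y)]) ->
   exists x y, [/\ (x <= y)%O, inbox s (h x), inbox t (h y),
     supp x `<=` pair_supp s t & supp y `<=` pair_supp s t]).
Proof.
rewrite /pair_supp; case: xgetP => [C -> []//|/(_ _) none]; exfalso.
have [ex|nex] := pselect (exists x y, [/\ (x <= y)%O, inbox s (h x) & inbox t (h y)]).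
  have [x [y [xy sx ty cx cy]]] := sigma_pair ex.
  apply: (none (supp x `|` supp y)); split; first exact: countableU.
  by move=> _; exists x, y; split.
by apply: (none set0); split.
Qed.

Definition side_supp b p s : set I := xget set0 [set C | countable C /\
  ((exists2 x, ~~ dle b x p & inbox s (h x)) ->
   exists x, [/\ ~~ dle b x p, inbox s (h x) & supp x `<=` C])].

Lemma side_suppP b p s : countable (side_supp b p s) /\
  ((exists2 x, ~~ dle b x p & inbox s (h x)) ->
   exists x, [/\ ~~ dle b x p, inbox s (h x) & supp x `<=` side_supp b p s]).
Proof.
rewrite /side_supp; case: xgetP => [C -> []//|/(_ _) none]; exfalso.
have [[x px sx]|nex] := pselect (exists2 x, ~~ dle b x p & inbox s (h x)).
  have [z [sz pz] cz] := sigma_dense (openI (box_openX s) (dle_openC b p)) (conj sx px).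
  by apply: (none (supp z)); split => // _; exists z; split.
by apply: (none set0); split.
Qed.

Lemma good_hull S : countable S -> exists T, [/\ countable T, S `<=` T & good T].
Proof.
move=> cS; have [|T [cT ST TP]] := @countable_hull I pair_supp S _ cS.
  by move=> s t; case: (pair_suppP s t).
exists T; split => // s t sT tT ex; have [_ /(_ ex) [x [y [xy sx ty xC yC]]]] := pair_suppP s t.
by exists x, y; split => // i; [move=> /xC|move=> /yC]; apply: TP sT tT _.
Qed.

(** Suppose [z] beyond [p] agrees with [p] on [S]. Closure under [side_supp] yields a point [x]
    supported on [S] strictly between [p] and [z]. It is its own retract, yet monotonicity places it
    no further than [retr S z = p]. *)
Lemma sigma_determined p : countable (supp p) ->
  exists2 S, countable S & forall z, agree S z p -> z = p.
Proof.
move=> cp; pose Phi s t := pair_supp s t `|` (side_supp true p s `|` side_supp false p s).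
have [|S [cS pS SP]] := @countable_hull I Phi (supp p) _ cp.
  move=> s t; apply: countableU; first by case: (pair_suppP s t).
  by apply: countableU; [case: (side_suppP true p s)|case: (side_suppP false p s)].
have gS : good S.
  move=> s t sT tT ex; have [_ /(_ ex) [x [y [xy sx ty xC yC]]]] := pair_suppP s t.
  by exists x, y; split => // i; [move=> /xC|move=> /yC] => Ci; apply: (SP s t sT tT); left.
have side b s i : over S s -> side_supp b p s i -> S i.
  by move=> os si; apply: (SP s s os os); right; case: b si; [left|right].
exists S => // z zp; apply: contrapT => nzp; have [b pz] := dle_neq (nesym nzp).
have rz : retr S z = p by rewrite (retr_eq gS zp) retr_id.
have [|s [os sz sU]] := @retr_box S z [set w | ~~ dle b z w] gS (dle_open b z).
  by rewrite /= rz.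
have [_ [|x [px sx xS]]] := side_suppP b p s; first by exists z.
have xS' : supp x `<=` S by move=> i /xS; apply: side.
move: (sU _ sx) => /=; rewrite retr_id // => zx.
have := retr_dle gS (dleN zx); rewrite rz retr_id // => xp.
by rewrite xp in px.
Qed.

Definition determining p : set I := xget set0 [set S | countable S /\
  (countable (supp p) -> forall z, agree S z p -> z = p)].

Lemma determiningP p : countable (determining p) /\
  (countable (supp p) -> forall z, agree (determining p) z p -> z = p).
Proof.
rewrite /determining; case: xgetP => [C -> []//|/(_ _) none]; exfalso.
have [cp|ncp] := pselect (countable (supp p)); last by apply: (none set0); split.
by have [S cS SP] := sigma_determined cp; apply: (none S); split.
Qed.

Lemma good_chain (D : Type) (P : set D) (S : D -> set I) : P !=set0 ->
  (forall a b, P a -> P b -> exists c, [/\ P c, S a `<=` S c & S b `<=` S c]) ->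
  (forall a, P a -> good (S a)) -> good (\bigcup_(a in P) S a).
Proof.
move=> P0 ch gS s t os ot ex.
have [a Pa oa] := over_chain P0 ch os; have [b Pb ob] := over_chain P0 ch ot.
have [c [Pc ac bc]] := ch a b Pa Pb.
have [x [y [xy sx ty xS yS]]] := gS c Pc s t (over_sub ac oa) (over_sub bc ob) ex.
by exists x, y; split => // i; [move=> /xS|move=> /yS] => ?; exists c.
Qed.

(** * Chains of good sets and initial segments *)

(** Recovers the base point of a fibre from the box that cuts the fibre off. Boxes over a countable
    [S] are countable in number, hence so are these base points. *)
Definition edge_point (x0 : X) S (q : bool * box) : X :=
  xget x0 [set p | supp p `<=` S /\ down_box q.1 q.2 = [set w | dle q.1 (retr S w) p]].

Lemma edge_pointE x0 S b s p : good S -> supp p `<=` S ->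
  down_box b s = [set w | dle b (retr S w) p] -> edge_point x0 S (b, s) = p.
Proof.
move=> gS pS sp; rewrite /edge_point; case: xgetP => [q _ /= [qS sq]|/(_ p) none]; last first.
  by exfalso; apply: none.
have pq : [set w | dle b (retr S w) p] = [set w | dle b (retr S w) q] by rewrite -sp -sq.
apply: (@dle_anti _ _ b).
  have : [set w | dle b (retr S w) q] q by rewrite /= retr_id // dle_refl.
  by rewrite -pq /= retr_id.
have : [set w | dle b (retr S w) p] p by rewrite /= retr_id // dle_refl.
by rewrite pq /= retr_id.
Qed.

Definition edge_determining (x0 : X) S : set I :=
  \bigcup_(q in [set q : bool * box | over S q.2]) determining (edge_point x0 S q).

Lemma edge_determining_countable x0 S : countable S -> countable (edge_determining x0 S).
Proof.
move=> cS; apply: bigcup_countable => [|q _]; last by case: (determiningP (edge_point x0 S q)).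
apply: (@countableS _ _ ([set: bool] `*` [set s | over S s])); first by move=> q.
by apply: countableX (over_countable cS); apply: countableP.
Qed.

Lemma good_sequence (x0 : X) : exists S : omega1 -> set I,
  [/\ forall a, countable (S a), forall a, good (S a),
      forall a b, (b < a)%O -> S b `<=` S a &
      forall a b, (b < a)%O -> edge_determining x0 (S b) `<=` S a].
Proof.
(* Countability is a premise here because the recursion needs a total function; [cB] establishes it
   afterwards by induction. *)
have hull (B : set I) : exists T, countable B -> [/\ countable T, B `<=` T & good T].
  have [cB|ncB] := pselect (countable B); last by exists set0.
  by have [T TP] := good_hull cB; exists T.
have /choice [hl hlP] := hull.
pose G (a : omega1) (f : omega1 -> set I) :=
  hl (\bigcup_(b in [set b | (b < a)%O]) (f b `|` edge_determining x0 (f b))).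
have [S SE] := wf_recursion set0 G (omega1_wf omega1P).
pose B a := \bigcup_(b in [set b | (b < a)%O]) (S b `|` edge_determining x0 (S b)).
have SB a : S a = hl (B a).
  rewrite SE /G /B; congr (hl _); apply/seteqP; split => i [b ba].
    by rewrite asboolT //; exists b.
  by move=> hi; exists b => //; rewrite asboolT.
have cB a : countable (B a).
  elim/(well_founded_ind (omega1_wf omega1P)): a => a IH.
  apply: bigcup_countable => [|b /= ba]; first by case: omega1P.
  have [cS _ _] := hlP _ (IH b ba); rewrite -SB in cS.
  by apply: countableU => //; apply: edge_determining_countable.
exists S; split => a.
- by rewrite SB; case: (hlP _ (cB a)).
- by rewrite SB; case: (hlP _ (cB a)).
- by move=> b ba i Si; rewrite SB; case: (hlP _ (cB a)) => _ + _; apply; exists b => //; left.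
- by move=> b ba i Si; rewrite SB; case: (hlP _ (cB a)) => _ + _; apply; exists b => //; right.
Qed.

Section Sequence.
Context (x0 : X) (S : omega1 -> set I).
Hypothesis S_countable : forall a, countable (S a).
Hypothesis S_good : forall a, good (S a).
Hypothesis S_mono : forall a b, (b < a)%O -> S b `<=` S a.
Hypothesis S_edge : forall a b, (b < a)%O -> edge_determining x0 (S b) `<=` S a.
Implicit Types (a b : omega1) (J : set X).

Lemma S_le a b : (b <= a)%O -> S b `<=` S a.
Proof. by rewrite le_eqVlt => /orP[/eqP ->|/S_mono]. Qed.

Lemma S_chain (P : set omega1) a b : P a -> P b ->
  exists c, [/\ P c, S a `<=` S c & S b `<=` S c].
Proof.
move=> Pa Pb; have [ab|ba] := leP a b; first by exists b; split => //; apply: S_le.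
by exists a; split => //; apply: S_mono.
Qed.

Definition before a : set I := \bigcup_(b in [set b | (b < a)%O]) S b.

Lemma before_good a b : (b < a)%O -> good (before a).
Proof. by move=> ba; apply: good_chain => // *; [exists b|apply: S_chain]. Qed.

Lemma S_before a b : (b < a)%O -> S b `<=` before a.
Proof. by move=> ba i Si; exists b. Qed.

Lemma before_sub a b : (b < a)%O -> before b `<=` before a.
Proof. by move=> ba i [c /= cb Sc]; exists c => //=; apply: lt_trans ba. Qed.

Lemma S_total : good (\bigcup_(a in setT) S a).
Proof.
have [a _] := omega1_bounded omega1P (@countable0 omega1).
by apply: good_chain => // *; [exists a|apply: S_chain].
Qed.

Lemma retr_total w : retr (\bigcup_(a in setT) S a) w = w.
Proof.
set U := \bigcup_(a in setT) S a; apply: contrapT => nw.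
have [c cw] := dle_neq nw; pose p := retr U w.
have [s os sE] := edge_box S_total cw erefl.
have [v sv wv] : down_box c s w by rewrite sE /= dle_refl.
have vp : ~~ dle c v p by apply: contra cw => vp; apply: dle_trans vp.
(* A Sigma-point in the fibre over [p]; its support contains that of [p], so [p] is a Sigma-point
   too. *)
have [u [su up] cu] := sigma_dense (openI (box_openX s) (dle_openC c p)) (conj sv vp).
have ru : retr U u = p.
  apply: (@dle_anti _ _ c).
    have : down_box c s u by exists u => //; apply: dle_refl.
    by rewrite sE.
  by have := retr_dle S_total (dleN up); rewrite retr_retr //; apply: S_total.
have cp : countable (supp p).
  apply: countableS cu => i; rewrite /supp /= -ru.
  have [Ui|nUi] := pselect (U i); first by rewrite (retr_agree _ S_total).
  by rewrite (@supp0 U) ?eqxx //; apply: supp_retr; apply: S_total.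
have [b pb] : exists b, supp p `<=` S b.
  have /choice [g gP] : forall i, exists a, supp p i -> S a i.
    move=> i; have [pi|npi] := pselect (supp p i); last first.
      by have [a _] := omega1_bounded omega1P (@countable0 omega1); exists a.
    by have [a _ Sa] := supp_retr S_total pi; exists a.
  have [b bP] := omega1_bounded omega1P (countable_img g cp).
  by exists b => i pi; apply: (S_mono _ (gP i pi)); apply: bP; exists i.
have rbw : retr (S b) w = p.
  have bU : S b `<=` U by move=> i Si; exists b.
  have [<- _] := retr_sub w (@S_good b) S_total bU.
  by apply: retr_id.
(* Already over [S b] the point [w] retracts to [p], so [p] is an edge point there and the next
   stage contains coordinates that determine it. *)
have [|s' os' s'E] := @edge_box c (S b) w w (@S_good b) _ erefl; first by rewrite rbw.
have [b' bb' _] := omega1_succ omega1P b.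
have [_ /(_ cp)] := determiningP p; move=> /(_ w) dp; apply: nw; rewrite -/p; apply/esym/dp.
move=> i di; have Ui : U i.
  exists b' => //; apply: (S_edge bb'); exists (c, s') => //.
  by rewrite (@edge_pointE _ _ _ _ p) //; rewrite s'E rbw.
by rewrite /p (retr_agree _ S_total).
Qed.

Definition sat (T : set I) J : Prop := forall x y, agree T x y -> J x -> J y.

(** The upper edge of a fibre is cut out by a downward closure, the lower edge by the complement of
    an upward closure; both are initial segments. *)
Definition segment_box (b : bool) s : set X :=
  if b then down_box true s else ~` down_box false s.

(** The second condition places a segment at the first level whose coordinates decide it, so levels
    are disjoint. [set0] and [setT] are decided by no coordinates and belong to no level. *)
Definition segments a : set (set X) :=
  [set J | (exists (b : bool) s, over (S a) s /\ J = segment_box b s) /\ ~ sat (before a) J].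

Definition segments_before a : set (set X) :=
  [set J | J = set0 \/ J = setT \/ exists2 b, (b < a)%O & segments b J].

Lemma agree_sym T x y : agree T x y -> agree T y x.
Proof. by move=> xy i /xy. Qed.

Lemma satC T J : sat T J -> sat T (~` J).
Proof. by move=> sJ x y /agree_sym xy nJx Jy; apply/nJx/(sJ y). Qed.

Lemma sat_sub T T' J : T `<=` T' -> sat T J -> sat T' J.
Proof. by move=> TT' sJ x y xy; apply: sJ => i /TT' /xy. Qed.

(** If [x] and [v] have the same retract, [y] lies in the box itself; otherwise their retracts are
    strictly ordered and force [y] to the same side of [v]. *)
Lemma down_box_sat (b : bool) s T : good T -> over T s -> sat T (down_box b s).
Proof.
move=> gT os x y xy [v sv xv].
have [rxv|rxv] := eqVneq (retr T x) (retr T v).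
  exists y; last exact: dle_refl.
  apply: inbox_ext os _ sv; apply/agree_sym => i Ti.
  by rewrite -(xy i Ti) (eq_retr gT rxv Ti).
exists v => //; have [//|vy] := dle_total b y v; exfalso; move/eqP: rxv; apply.
apply: (@dle_anti _ _ b); first exact: retr_dle.
by rewrite (retr_eq gT xy); apply: retr_dle.
Qed.

Lemma segments_down a J : segments a J -> forall x y, (y <= x)%O -> J x -> J y.
Proof.
move=> [[b [s [_ ->]]] _] x y yx; case: b => /=.
  by move=> [v sv xv]; exists v => //; apply: le_trans xv.
by move=> nx [v sv vy]; apply: nx; exists v => //; apply: le_trans yx.
Qed.

Lemma segments_sat a J : segments a J -> sat (S a) J.
Proof.
move=> [[b [s [os ->]]] _]; case: b => /=; first exact: down_box_sat.
by apply: satC; apply: down_box_sat.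
Qed.

Lemma segments_before_sat a J : segments_before a J -> sat (before a) J.
Proof.
by move=> [->|[->|[b ba Jb]]] //; apply: sat_sub (S_before ba) (segments_sat Jb).
Qed.

Lemma segments_before_down a J : segments_before a J ->
  forall x y, (y <= x)%O -> J x -> J y.
Proof. by move=> [->|[->|[b _ /segments_down]]]. Qed.

Lemma segments_unique a b J : segments a J -> segments b J -> a = b.
Proof.
move=> Ja Jb; case: (ltgtP a b) => // ab; exfalso.
  case: Jb => _; apply; apply: sat_sub (S_before ab) _; exact: segments_sat.
case: Ja => _; apply; apply: sat_sub (S_before ab) _; exact: segments_sat.
Qed.

Lemma segments_countable a : countable (segments a).
Proof.
apply: (@countableS _ _ ((fun q : bool * box => segment_box q.1 q.2) @`
  ([set: bool] `*` [set s | over (S a) s]))).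
  by move=> J [[b [s [os ->]]] _]; exists (b, s).
apply: countable_img; apply: countableX (over_countable (S_countable a)).
exact: countableP.
Qed.

(** At the first stage [a] where [z] and [x] differ, their retracts are strictly ordered, and a box
    around [z] over that stage separates them. *)
Lemma segments_separate z x : (z < x)%O -> exists a J, [/\ segments a J, J z & ~ J x].
Proof.
move=> zx; have [a0 na0] : exists a, ~ agree (S a) z x.
  apply: contrapT => /forallNP eqS; move: zx; rewrite -(retr_total z) -(retr_total x).
  rewrite (@retr_eq _ z x) ?ltxx //; first exact: S_total.
  by move=> i [a _ Sa]; have /contrapT := eqS a; apply.
have [a na mina] := omega1_min omega1P (A := [set a | ~ agree (S a) z x]) (ex_intro _ a0 na0).
have rzx : (retr (S a) z < retr (S a) x)%O.
  rewrite lt_neqAle (retr_homo (@S_good a) (ltW zx)) andbT; apply/eqP => e.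
  by apply: na; apply: eq_retr e.
have [|s [os sz sU]] := @retr_box (S a) z `]-oo, retr (S a) x[%classic (@S_good a) (lray_open _).
  by rewrite /= in_itv.
have Jz : segment_box true s z by exists z => //=.
have nJx : ~ segment_box true s x.
  move=> [v /sU /=]; rewrite in_itv /= => rvx /(retr_homo (@S_good a)).
  by rewrite leNgt rvx.
exists a, (segment_box true s); split => //; split; first by exists true, s.
move=> sJ; apply: nJx; apply: sJ Jz => i [b /= ba Sb].
have [|/mina] := pselect (agree (S b) z x); first by apply.
by rewrite leNgt ba.
Qed.

(* The least index at which the edge of a fibre over [before a] is cut out by a
   box is the one at which it enters the family. *)
Lemma edge_segment a a' c w0 : (a' < a)%O -> ~~ dle c w0 (retr (before a) w0) ->
  let Q := [set w | dle c (retr (before a) w) (retr (before a) w0)] in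
  segments_before a (if c then Q else ~` Q).
Proof.
move=> a'a cw0 Q; set T := before a; set p := retr T w0.
have gT : good T := before_good a'a.
have [s os sE] := edge_box gT cw0 erefl.
have ne : [set b | (b < a)%O] !=set0 by exists a'.
have [b0 b0a os0] := over_chain ne (fun b b' => @S_chain _ b b') os.
have [b [s1 os1 s1E] minb] := omega1_min omega1P
  (A := [set b | exists2 s, over (S b) s & down_box c s = Q])
  (ex_intro _ b0 (ex_intro2 _ _ s os0 sE)).
have ba : (b < a)%O by apply: le_lt_trans b0a; apply: minb; exists s.
have Qw0 : Q w0 by rewrite /Q /= dle_refl.
have [satQ|nsatQ] := pselect (sat (before b) Q); last first.
  right; right; exists b => //; split.
    by exists c, s1; split => //; case: c {cw0 p sE minb s1E} @Q sE s1E Qw0 nsatQ => Q _ <-.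
  case: (c) => // satC'; apply: nsatQ; rewrite -[Q]setCK; exact: satC.
(* With no stage before [b], saturation refers to no coordinates and forces [Q] to be everything. *)
have [[b' b'b]|nb] := pselect (exists b', (b' < b)%O); last first.
  have QT : Q = setT.
    rewrite -subTset => w _; apply: satQ Qw0 => i [b' /= b'b _].
    by exfalso; apply: nb; exists b'.
  by rewrite QT; case: (c); [right; left|left; rewrite setCT].
(* Otherwise [Q] is also the edge of a fibre over [before b], so a box from a stage before [b] cuts
   it out, against the choice of [b]. *)
exfalso; have gT' : good (before b) := before_good b'b.
have [rTT' rT'T] : (forall w, retr (before b) (retr T w) = retr (before b) w) /\
    forall w, retr T (retr (before b) w) = retr (before b) w.
  by split => w; case: (retr_sub w gT' gT (before_sub ba)).
have Qr w : Q w -> dle c (retr (before b) w) p.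
  move=> Qw; have : Q (retr (before b) w).
    by apply: satQ Qw => i /(retr_agree w gT') ->.
  by rewrite /Q /= rT'T.
have [|s2 os2 s2E] := @edge_box c (before b) w0 w0 gT' _ erefl.
  by apply: contra cw0 => qw0; apply: dle_trans qw0 (Qr _ Qw0).
have s2Q : down_box c s2 = Q.
  rewrite s2E; apply/seteqP; split => w /=; last first.
    move=> /Qr /(retr_dle gT'); rewrite retr_retr //.
    by rewrite /p rTT'.
  move=> le; apply: contrapT => nQw.
  have w0w : dle c w0 w.
    have [//|ww0] := dle_total c w0 w; exfalso; apply: nQw.
    exact: (retr_dle gT ww0).
  apply: nQw; apply: satQ Qw0; apply: eq_retr => //.
  by apply: (@dle_anti _ _ c) => //; apply: retr_dle.
have ne' : [set b' | (b' < b)%O] !=set0 by exists b'.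
have [b2 b2b os2'] := over_chain ne' (fun b b' => @S_chain _ b b') os2.
have : (b <= b2)%O by apply: minb; exists s2.
by rewrite leNgt b2b.
Qed.

(** [J] splits a fibre over [before a], while earlier segments contain a fibre or miss it. The fibre
    extends past its base point on some side, and the edge on that side is itself an earlier
    segment, hence the nearest one. *)
Lemma segments_parent a J : segments a J -> exists2 m, segments_before a m &
  (m `<=` J /\ forall n, segments_before a n -> n `<=` J -> n `<=` m) \/
  (J `<=` m /\ forall n, segments_before a n -> J `<=` n -> m `<=` n).
Proof.
move=> Ja; have Jd := segments_down Ja; case: (Ja) => _ /existsNP [z /existsNP [x]].
move=> /not_implyP [zx /not_implyP [Jz nJx]].
have [[a' a'a]|na] := pselect (exists a', (a' < a)%O); last first.
  exists set0; first by left.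
  left; split; first by [].
  move=> n [->//|[->|[b ba _ _]]]; last by exfalso; apply: na; exists b.
    by move=> _.
  by move=> TJ; exfalso; apply: nJx; apply: TJ.
have gT : good (before a) := before_good a'a.
have rzx := retr_eq gT zx.
have key c w0 : retr (before a) w0 = retr (before a) x ->
  ~~ dle c w0 (retr (before a) x) ->
  let Q := [set w | dle c (retr (before a) w) (retr (before a) x)] in
  segments_before a (if c then Q else ~` Q).
  by move=> e cw0; have := @edge_segment a a' c w0 a'a; rewrite e; apply.
have zx' : (z < x)%O by rewrite ltNge; apply/negP => /Jd /(_ Jz).
have [px|xp] := ltP (retr (before a) x) x.
  have mN := @key true x erefl; rewrite /= -ltNge in mN.
  exists [set w | (retr (before a) w <= retr (before a) x)%O]; first exact: mN.
  right; split => [w Jw /=|n nN Jn w /= wx].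
    rewrite leNgt; apply/negP => xw; apply: nJx; apply: Jd Jw.
    by rewrite leNgt; apply/negP => /ltW /(retr_homo gT); rewrite leNgt xw.
  apply: contrapT => nw; have nz := Jn _ Jz.
  have zw : (z <= w)%O by rewrite leNgt; apply/negP => /ltW /(segments_before_down nN) /(_ nz).
  apply: nw; apply: (segments_before_sat nN) nz; apply: eq_retr => //.
  by apply/le_anti; rewrite (retr_homo gT zw) rzx wx.
have mN := @key false z rzx; rewrite /= -ltNge in mN.
exists (~` [set w | (retr (before a) x <= retr (before a) w)%O]).
  by apply: mN; apply: lt_le_trans xp.
left; split => [w /= nw|n nN nJ w nw /= xw].
  apply: contrapT => nJw; apply: nw; rewrite -rzx; apply: retr_homo => //.
  by rewrite leNgt; apply/negP => /ltW /Jd /(_ Jz).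
have nx : ~ n x by move=> /nJ.
have wx : (w <= x)%O by rewrite leNgt; apply/negP => /ltW /(segments_before_down nN) /(_ nw).
apply: nx; apply: (segments_before_sat nN) nw; apply: eq_retr => //.
by apply/le_anti; rewrite (retr_homo gT wx) xw.
Qed.

End Sequence.

End GoodSets.

(** * Embedding of segments and increasing surjections *)

(** Guarantees that moving off a parent by a new basis vector never passes an element placed
    earlier. *)
Lemma lex_gap (x y : lexgrp) r : (forall v, (r <= v)%O -> x v = 0) ->
  (forall v, (r <= v)%O -> y v = 0) -> x < y -> lexdelta r < y - x.
Proof.
move=> x0 y0; rewrite -lex_subgt0 => /lexltP [v yx0 yxv].
apply: (@lexdelta_lt_lead _ v) => //; first by move=> u /yx0; rewrite lex0.
by rewrite ltNge; apply/negP => rv; move: yxv; rewrite lex0 lexB x0 // y0 // subrr ltxx.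
Qed.

Section RankedEmbedding.
Context {T : Type} (prec : T -> T -> Prop) (D : set T) (bot : T) (rk : T -> oindex).
(** [bot] precedes everything whatever its rank, which leaves the least rank free for the top
    segment. *)
Definition ranked_before (y x : T) : Prop := x <> bot /\ (y = bot \/ (rk y < rk x)%O).
Hypothesis prec_irr : forall x, ~ prec x x.
Hypothesis prec_trans : forall x y z, prec x y -> prec y z -> prec x z.
Hypothesis bot_prec : forall x, D x -> x <> bot -> prec bot x.
Hypothesis rk_inj : forall x y, D x -> D y -> x <> bot -> y <> bot -> rk x = rk y -> x = y.
Hypothesis parent : forall x, D x -> x <> bot -> exists m, [/\ D m, ranked_before m x &
  (prec m x /\ forall n, D n -> ranked_before n x -> prec n x -> n = m \/ prec n m) \/
  (prec x m /\ forall n, D n -> ranked_before n x -> prec x n -> n = m \/ prec m n)].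

Lemma ranked_before_wf : well_founded ranked_before.
Proof.
have bA : Acc ranked_before bot by constructor => y [].
suff h v : forall x, rk x = v -> Acc ranked_before x by move=> x; apply: h.
elim/(well_founded_ind (omega1_wf oindexP)): v => v IH x xv; constructor => y [_ [->//|yx]].
by apply: (IH (rk y)) => //; rewrite -xv.
Qed.

(* Each element is placed a new infinitesimal [lexdelta (rk x)] above or below
   its parent. *)
Lemma ranked_embedding : exists j : T -> lexgrp, [/\ j bot = 0,
  forall x y, D x -> D y -> prec x y -> j x < j y &
  forall x, D x -> x <> bot -> (forall y, (rk x <= rk y)%O) -> j x = lexdelta (rk x)].
Proof.
have hp x : exists q : T * bool, D x -> x <> bot -> [/\ D q.1, ranked_before q.1 x &
    if q.2 then prec q.1 x /\ forall n, D n -> ranked_before n x -> prec n x -> n = q.1 \/ prec n q.1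
    else prec x q.1 /\ forall n, D n -> ranked_before n x -> prec x n -> n = q.1 \/ prec q.1 n].
  have [[Dx xb]|nx] := pselect (D x /\ x <> bot); last first.
    by exists (x, true) => Dx xb; exfalso; apply: nx.
  by have [m [Dm mx [mP|mP]]] := parent Dx xb; [exists (m, true)|exists (m, false)].
have {hp} /choice [q qP] := hp.
pose sg (x : T) : lexgrp := if (q x).2 then lexdelta (rk x) else - lexdelta (rk x).
pose F x (j : T -> lexgrp) := if `[< x = bot >] then 0 else j (q x).1 + sg x.
have [j jE] := wf_recursion (0 : lexgrp) F ranked_before_wf.
have jbot : j bot = 0 by rewrite jE /F asboolT.
have jS x : D x -> x <> bot -> j x = j (q x).1 + sg x.
  move=> Dx xb; rewrite jE /F asboolF // asboolT //.
  by case: (qP x Dx xb).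
have j0 x : D x -> forall v, x = bot \/ (rk x < v)%O -> j x v = 0.
  elim/(well_founded_ind ranked_before_wf): x => x IH Dx v xv.
  have [xb|xb] := pselect (x = bot); first by rewrite xb jbot lex0.
  have xv' : (rk x < v)%O by case: xv.
  have [Dm mx _] := qP x Dx xb.
  rewrite jS // lexD (IH _ mx) //; last first.
    by case: mx => _ [|rmx]; [left|right; apply: (lt_trans rmx)].
  by rewrite /sg; case: (q x).2; rewrite ?lexN lexdeltaE gt_eqF // ?oppr0 addr0.
have j0' x y : D y -> ranked_before y x -> forall v, (rk x <= v)%O -> j y v = 0.
  move=> Dy [_ yx] v xv; apply: j0 => //; case: yx => [|yx]; first by left.
  by right; apply: lt_le_trans xv.
have main x : D x -> x <> bot -> forall y, D y -> ranked_before y x ->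
    (prec x y -> j x < j y) /\ (prec y x -> j y < j x).
  elim/(well_founded_ind ranked_before_wf): x => x IH Dx xb y Dy yx.
  have IH' u w : D u -> D w -> ranked_before u x -> ranked_before w x -> prec u w -> j u < j w.
    move=> Du Dw ux wx uw.
    have [ub|ub] := pselect (u = bot).
      have wb : w <> bot by move=> wb; move: uw; rewrite ub wb; apply: prec_irr.
      by have [_] := IH w wx Dw wb u Du (conj wb (or_introl ub)); apply.
    have [wb|wb] := pselect (w = bot).
      by have [+ _] := IH u ux Du ub w Dw (conj ub (or_introl wb)); apply.
    case: (ltgtP (rk u) (rk w)) => [ruw|rwu|ruw].
    - by have [_] := IH w wx Dw wb u Du (conj wb (or_intror ruw)); apply.
    - by have [+ _] := IH u ux Du ub w Dw (conj ub (or_intror rwu)); apply.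
    - by move: uw; rewrite (rk_inj Du Dw ub wb ruw) => /prec_irr.
  have [Dm mx] := qP x Dx xb; rewrite jS // /sg; set m := (q x).1 in Dm mx *.
  case: (q x).2 => -[mlt mP]; split => xy.
  - have jmy : j m < j y by apply: IH' => //; apply: prec_trans xy.
    rewrite -lex_subgt0 opprD addrA lex_subgt0.
    by apply: lex_gap => //; exact: j0'.
  - have jy : j y <= j m.
      by have [->//|ym] := mP y Dy yx xy; apply: ltW; apply: IH'.
    apply: le_lt_trans jy _; rewrite -{1}(addr0 (j m)) lex_ltD2l; exact: lexdelta_gt0.
  - have jy : j m <= j y.
      by have [->//|ym] := mP y Dy yx xy; apply: ltW; apply: IH'.
    apply: lt_le_trans jy; rewrite -lex_subgt0 opprB addrC subrK; exact: lexdelta_gt0.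
  - have jmy : j y < j m by apply: IH' => //; apply: prec_trans mlt.
    by rewrite lex_ltBC; apply: lex_gap => //; exact: j0'.
exists j; split => //.
  move=> x y Dx Dy xy; have [xb|xb] := pselect (x = bot).
    have yb : y <> bot by move=> yb; move: xy; rewrite xb yb; apply: prec_irr.
    by have [_] := main y Dy yb x Dx (conj yb (or_introl xb)); apply.
  have [yb|yb] := pselect (y = bot).
    by have [+ _] := main x Dx xb y Dy (conj xb (or_introl yb)); apply.
  case: (ltgtP (rk x) (rk y)) => [rxy|ryx|rxy].
  - by have [_] := main y Dy yb x Dx (conj yb (or_intror rxy)); apply.
  - by have [+ _] := main x Dx xb y Dy (conj xb (or_intror ryx)); apply.
  - by move: xy; rewrite (rk_inj Dx Dy xb yb rxy) => /prec_irr.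
move=> x Dx xb xmin; have [Dm [_ mx] qx] := qP x Dx xb.
have mb : (q x).1 = bot by case: mx => // ; rewrite ltNge xmin.
rewrite jS // mb jbot add0r /sg; case: (q x).2 qx => // -[]; rewrite mb => xbot.
by case: (prec_irr (prec_trans xbot (bot_prec Dx xb))).
Qed.

End RankedEmbedding.

(** * Increasing surjections onto compact orders *)

Section CompactOrder.
Context {d : Order.disp_t} {X : orderTopologicalType d}.
Hypothesis X_compact : compact [set: X].
Hypothesis X_nonempty : [set: X] !=set0.

Lemma closed_cluster (F : set_system X) (A : set X) z : closed A -> F A -> cluster F z -> A z.
Proof.
move=> cA FA zF; apply: cA => B /(zF _ _ FA) [w [Aw Bw]].
by exists w.
Qed.

Lemma compact_order_max : exists m : X, forall x, (x <= m)%O.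
Proof.
pose F := filter_from [set: X] (fun x => `[x, +oo[%classic).
have FF : ProperFilter F.
  apply: filter_from_proper; last by move=> x _; exists x; rewrite /= in_itv /= lexx.
  apply: filter_from_filter; first by case: X_nonempty => x _; exists x.
  move=> x y _ _; exists (Order.max x y) => // z.
  by rewrite /= in_itv /= andbT ge_max => /andP[xz yz]; split; rewrite /= in_itv /= ?xz ?yz.
have [|m [_ mF]] := X_compact FF; first exact: filterT.
exists m => x; have : `[x, +oo[%classic m.
  by apply: closed_cluster mF; [exact: rray_closed|exists x].
by rewrite /= in_itv /= andbT.
Qed.

(** A cluster point of the sets squeezed between the lower bounds and the elements of [E]. Adjoining
    the maximum covers empty [E]. *)
Lemma compact_order_inf (E : set X) : exists g : X, (forall e, E e -> (g <= e)%O) /\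
  forall l, (forall e, E e -> (l <= e)%O) -> (l <= g)%O.
Proof.
have [m mP] := compact_order_max.
pose E' := E `|` [set m]; pose L := [set l | forall e, E' e -> (l <= e)%O].
pose B e := [set z | (z <= e)%O /\ forall l, L l -> (l <= z)%O].
pose F := filter_from E' B.
have FF : ProperFilter F.
  apply: filter_from_proper; last by move=> e Ee; exists e; split => // l; apply.
  apply: filter_from_filter; first by exists m; right.
  move=> x y Ex Ey; exists (Order.min x y); first by case: leP.
  by move=> z [+ Lz]; rewrite le_min => /andP[zx zy]; split.
have [|g [_ gF]] := X_compact FF; first exact: filterT.
have gE e : E' e -> (g <= e)%O.
  move=> Ee; have : `]-oo, e]%classic g.
    apply: closed_cluster gF; first exact: lray_closed.
    by exists e => // z [ze _]; rewrite /= in_itv.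
  by rewrite /= in_itv.
have Lg l : L l -> (l <= g)%O.
  move=> Ll; have : `[l, +oo[%classic g.
    apply: closed_cluster gF; first exact: rray_closed.
    by exists m; [right|move=> z [_ /(_ l Ll) lz]; rewrite /= in_itv /= lz].
  by rewrite /= in_itv /= andbT.
exists g; split; first by move=> e Ee; apply: gE; left.
by move=> l lE; apply: Lg => e [/lE|->].
Qed.

Lemma order_continuous (Z : topologicalType) (f : Z -> X) :
  (forall c, open [set z | (f z < c)%O]) -> (forall c, open [set z | (c < f z)%O]) ->
  continuous f.
Proof.
move=> o1 o2 z U /order_nbhs_option [l [r [lz rz lrU]]].
have nl : nbhs z [set w | forall a, l = Some a -> (a < f w)%O].
  case: l lz {lrU} => [a /(_ _ erefl) az|_]; last by apply: filterS filterT => w _ a.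
  by apply: filterS (open_nbhs_nbhs (conj (o2 a) az)) => w /= aw _ [<-].
have nr : nbhs z [set w | forall a, r = Some a -> (f w < a)%O].
  case: r rz {lrU nl} => [a /(_ _ erefl) az|_]; last by apply: filterS filterT => w _ a.
  by apply: filterS (open_nbhs_nbhs (conj (o1 a) az)) => w /= aw _ [<-].
by apply: filterS2 nl nr => w wl wr; apply: lrU.
Qed.

(* A cut [A] is sent to the infimum of the complement of the union of the
   segments lying in [A]. *)
Lemma separating_segments_image (D : set (set X)) (j : set X -> lexgrp) :
  (forall J, D J -> forall x y, (y <= x)%O -> J x -> J y) ->
  D set0 -> D setT -> j set0 = 0 -> j setT = lexdelta oindex0 ->
  (forall J J', D J -> D J' -> J `<=` J' -> J <> J' -> j J < j J') ->
  (forall z x, (z < x)%O -> exists2 J, D J & J z /\ ~ J x) ->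
  order_preserving_image cutspace X.
Proof.
move=> Ddown D0 DT j0 jT jlt Dsep.
have jle J J' : D J -> D J' -> j J <= j J' -> J `<=` J'.
  move=> DJ DJ' jJ x Jx; apply: contrapT => nJ'x.
  have J'J : J' `<=` J.
    move=> y J'y; apply: (Ddown J DJ x) Jx; rewrite leNgt; apply/negP => /ltW xy.
    by apply: nJ'x; apply: Ddown xy J'y.
  have : j J' < j J by apply: jlt => // e; rewrite e in nJ'x.
  by rewrite ltNge jJ.
pose C (A : cut) := [set w | forall J, D J -> A (j J) -> ~ J w].
have /choice [f fP] : forall A : cut, exists g : X, (forall e, C A e -> (g <= e)%O) /\
    forall l, (forall e, C A e -> (l <= e)%O) -> (l <= g)%O.
  by move=> A; apply: compact_order_inf.
have fle A e : C A e -> (f A <= e)%O by case: (fP A) => + _; apply.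
have fge A l : (forall e, C A e -> (l <= e)%O) -> (l <= f A)%O by case: (fP A) => _; apply.
have notC A w : ~ C A w -> exists2 J, D J & A (j J) /\ J w.
  move=> /existsNP [J /not_implyP [DJ /not_implyP [AJ /contrapT Jw]]].
  by exists J.
exists (f : cutspace -> X); split.
- apply: order_continuous => c.
    rewrite openE => A /= yc.
    have [e Ce ec] : exists2 e, C A e & (e < c)%O.
      apply: contrapT => nE; move: yc; rewrite ltNge => /negP; apply; apply: fge => e Ce.
      by rewrite leNgt; apply/negP => ec; apply: nE; exists e.
    (* Segments captured by a cut that omits [j J0] are proper parts of [J0] and must miss [y']. A
       point strictly between [e] and [c] serves as [y']; at a jump [J0] is the ray up to [e], whose
       proper parts miss [e]. *)
    have [J0 [DJ0 nAJ0 [y' y'c hy']]] : exists J0, [/\ D J0, ~ A (j J0) &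
        exists2 y', (y' < c)%O & forall J, D J -> J `<=` J0 -> J <> J0 -> ~ J y'].
      have [[y' /andP[ey' y'c]]|nb] := pselect (exists y', (e < y' < c)%O).
        have [J0 DJ0 [J0e nJ0]] := Dsep _ _ ey'; exists J0; split => //.
          by move=> AJ0; apply: (Ce J0).
        by exists y' => // J _ JJ0 _ /JJ0.
      have [J0 DJ0 [J0e nJ0]] := Dsep _ _ ec; exists J0; split => //.
        by move=> AJ0; apply: (Ce J0).
      exists e => // J DJ JJ0 nJ Je; apply: nJ; apply/seteqP; split => // w J0w.
      apply: (Ddown J DJ e) Je; rewrite leNgt; apply/negP => ew.
      apply: nb; exists w; rewrite ew ltNge; apply/negP => cw.
      by apply: nJ0; apply: Ddown cw J0w.
    have : nbhs A [set B : cutspace | ~ (B : cut) (j J0)].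
      by apply: open_nbhs_nbhs; split => //; apply: cut_nmem_open.
    apply: filterS => B nBJ0 /=; apply: le_lt_trans y'c; apply: fle => J DJ BJ.
    have lt0 : j J < j J0 by apply: cut_lt BJ nBJ0.
    apply: hy' => //; first by apply: jle => //; apply: ltW.
    by move=> e'; rewrite e' ltxx in lt0.
  rewrite openE => A /= cy.
  have nC w : (w < f A)%O -> exists2 J, D J & A (j J) /\ J w.
    by move=> wy; apply: notC => /fle; rewrite leNgt wy.
  have fB (B : cut) J w : D J -> B (j J) -> (forall v, ~ J v -> (w <= v)%O) -> (w <= f B)%O.
    by move=> DJ BJ h; apply: fge => v Cv; apply: h; apply: Cv.
  have [J0 [DJ0 AJ0 [c' cc' hc']]] : exists J0, [/\ D J0, A (j J0) &
      exists2 c', (c < c')%O & forall v, ~ J0 v -> (c' <= v)%O].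
    have [[c' /andP[cc' c'y]]|nb] := pselect (exists c', (c < c' < f A)%O).
      have [J DJ [AJ Jc']] := nC _ c'y; exists J; split => //; exists c' => // v nJv.
      by rewrite leNgt; apply/negP => /ltW vc'; apply: nJv; apply: Ddown vc' Jc'.
    have [J DJ [AJ Jc]] := nC _ cy; exists J; split => //; exists (f A) => // v nJv.
    rewrite leNgt; apply/negP => vy; apply: nb; exists v; rewrite vy andbT ltNge.
    by apply/negP => vc; apply: nJv; apply: Ddown vc Jc.
  have : nbhs A [set B : cutspace | (B : cut) (j J0)].
    by apply: open_nbhs_nbhs; split => //; apply: cut_mem_open.
  by apply: filterS => B BJ0 /=; apply: lt_le_trans cc' _; apply: fB hc'.
- rewrite -subTset => x _.
  (* A preimage of [x] is generated by the images of the segments that miss [x]. *)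
  have [|||A AE] := @mk_cut [set g | exists J, [/\ D J, ~ J x & g <= j J]].
  - by move=> u v vu [J [DJ nJ uJ]]; exists J; split => //; apply: le_trans uJ.
  - by exists set0; split; rewrite ?j0.
  - move=> [J [DJ nJ]]; rewrite -jT => /(jle setT J DT DJ) TJ; apply: nJ; exact: TJ.
  have AJ J : D J -> A (j J) <-> ~ J x.
    move=> DJ; rewrite AE; split; last by move=> nJ; exists J.
    by move=> [J' [DJ' nJ' le]] Jx; exact: nJ' (jle J J' DJ DJ' le x Jx).
  exists A => //; apply/le_anti; apply/andP; split.
    by apply: fle => J DJ /AJ; apply.
  apply: fge => w Cw; rewrite leNgt; apply/negP => wx.
  by have [J DJ [Jw nJx]] := Dsep _ _ wx; apply: (Cw J) => //; apply/AJ.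
- move=> A B /cut_leP AB; apply: fge => e Ce; apply: fle => J DJ /AB BJ; exact: Ce.
Qed.

End CompactOrder.

Lemma lt_oindex0 (a : omega1) (k : nat) : (oindex0 < ((a, k.+1) : oindex))%O.
Proof. by apply: le_lt_trans (oindex0_le (a, k)) _; rewrite ltxi_pair lexx /= ltEnat /=. Qed.

Definition side_sub (T : Type) (b : bool) (J J' : set T) : Prop :=
  if b then J `<=` J' else J' `<=` J.

(* Inserting the countably many segments of one level one at a time keeps the
   nearest earlier segment on the chosen side. *)
Lemma nearest_earlier (T : Type) (b : bool) (L M : set (set T)) (f : set T -> nat)
    (J : set T) (k : nat) :
  (forall K K', L K \/ M K -> L K' \/ M K' -> K `<=` K' \/ K' `<=` K) ->
  {in M &, injective f} ->
  (exists2 m, L m & side_sub b m J /\ forall n, L n -> side_sub b n J -> side_sub b n m) ->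
  exists2 m, (L m \/ M m /\ (f m < k)%N) & side_sub b m J /\
    forall n, (L n \/ M n /\ (f n < k)%N) -> side_sub b n J -> side_sub b n m.
Proof.
move=> tot fi [m0 Lm0 [m0J m0max]].
have refl K : side_sub b K K by rewrite /side_sub; case: (b).
have trans K K' K'' : side_sub b K K' -> side_sub b K' K'' -> side_sub b K K''.
  by rewrite /side_sub; case: (b) => /= KK' K'K'' x; [move=> /KK' /K'K''|move=> /K'K'' /KK'].
have stot K K' : L K \/ M K -> L K' \/ M K' -> side_sub b K K' \/ side_sub b K' K.
  by move=> hK hK'; rewrite /side_sub; case: (tot _ _ hK hK') => ?; case: (b); auto.
elim: k => [|k [m Lm [mJ mmax]]].
  exists m0; first by left.
  by split => // n [Ln|[_]] //; apply: m0max.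
have LM n i : (L n \/ M n /\ (f n < i)%N) -> L n \/ M n by case=> [|[]]; [left|right].
have keep n : (L n \/ M n /\ (f n < k.+1)%N) -> (L n \/ M n /\ (f n < k)%N) \/ M n /\ f n = k.
  by move=> [Ln|[Mn]]; [left; left|rewrite ltnS leq_eqVlt => /orP[/eqP|]; [right|left; right]].
have up n : (L n \/ M n /\ (f n < k)%N) -> L n \/ M n /\ (f n < k.+1)%N.
  by move=> [|[Mn fn]]; [left|right; split => //; apply: ltnW].
have [[J' [MJ' fJ' J'J]]|nJ'] := pselect (exists J', [/\ M J', f J' = k & side_sub b J' J]); last first.
  exists m; first exact: up.
  split => // n /keep [|[Mn fn] nJ]; first exact: mmax.
  by exfalso; apply: nJ'; exists n.
have same n : M n /\ f n = k -> n = J'.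
  by move=> [Mn fn]; apply: fi; rewrite ?inE // fn.
have [mJ'|J'm] := stot m J' (LM _ _ Lm) (or_intror MJ').
  exists J'; first by right; rewrite fJ'.
  split => // n /keep [Ln nJ|/same -> //].
  exact: trans (mmax _ Ln nJ) mJ'.
exists m; first exact: up.
by split => // n /keep [|/same -> //]; apply: mmax.
Qed.

Lemma valdivia_image (R : realType) (d : Order.disp_t) (X : orderTopologicalType d) :
  linearly_ordered_valdivia_compact R X -> order_preserving_image cutspace X.
Proof.
move=> [X0 [cX [I [h [hemb _ hrange]]]]]; have [x0 _] := X0.
have [S [S1 S2 S3 S4]] := good_sequence hemb hrange x0.
pose N := segments h S; pose B := segments_before h S.
pose D := [set J : set X | J = set0 \/ J = setT \/ exists a, N a J].
have BN a J : B a J -> D J.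
  by move=> [->|[->|[b _ NbJ]]]; [left|right; left|right; right; exists b].
have ND a J : N a J -> D J by move=> NJ; right; right; exists a.
have T0 : (setT : set X) <> set0 by move=> e; have : (setT : set X) x0 by []; rewrite e.
have N0 a J : N a J -> J <> set0 /\ J <> setT.
  by move=> [_ ns]; split => e; apply: ns; rewrite e.
have Ddown J : D J -> forall x y, (y <= x)%O -> J x -> J y.
  move=> [->|[->|[a NJ]]] // x y; exact: segments_down NJ x y.
have Dtot J J' : D J -> D J' -> J `<=` J' \/ J' `<=` J.
  move=> DJ DJ'; have [|/existsNP [x /not_implyP [Jx nJ'x]]] := pselect (J `<=` J').
    by left.
  right => y J'y; apply: (Ddown J DJ x) Jx; rewrite leNgt; apply/negP => /ltW xy.
  by apply: nJ'x; apply: Ddown xy J'y.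
have /choice [f fP] : forall a, exists f : set X -> nat, {in N a &, injective f}.
  by move=> a; apply/countable_injP; apply: segments_countable.
(* The successor reserves [oindex0] for the whole space, which has to land on [lexdelta oindex0]. *)
pose rk J : oindex := if `[< J = setT >] then oindex0 else
  let a := xget (oindex0.1 : omega1) [set a | N a J] in (a, (f a J).+1).
have rkT : rk setT = oindex0 by rewrite /rk asboolT.
have rkN a J : N a J -> rk J = (a, (f a J).+1).
  move=> NJ; rewrite /rk asboolF; last by case: (N0 a J NJ).
  by case: xgetP => [b -> /(segments_unique hemb hrange S2 NJ) <-|/(_ a)].
have rkT_lt a J : N a J -> (rk setT < rk J)%O.
  by move=> NJ; rewrite rkT (rkN a) // lt_oindex0.
pose prec (J J' : set X) := J `<=` J' /\ J <> J'.
have prec_irr J : ~ prec J J by case.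
have prec_trans J1 J2 J3 : prec J1 J2 -> prec J2 J3 -> prec J1 J3.
  move=> [h12 n12] [h23 n23]; split; first exact: subset_trans h23.
  by move=> e; apply: n12; apply/seteqP; split => //; rewrite e.
have bot_prec J : D J -> J <> set0 -> prec set0 J by move=> _ nJ; split => //; apply/nesym.
have rk_inj J J' : D J -> D J' -> J <> set0 -> J' <> set0 -> rk J = rk J' -> J = J'.
  move=> [//|[->|[a NJ]]] [//|[->|[b NJ']]] // _ _.
  - by move=> e; have := rkT_lt _ _ NJ'; rewrite e ltxx.
  - by move=> e; have := rkT_lt _ _ NJ; rewrite e ltxx.
  - rewrite (rkN _ _ NJ) (rkN _ _ NJ') => -[ab]; subst b.
    by apply: fP; rewrite inE.
have parent J : D J -> J <> set0 -> exists m, [/\ D m, ranked_before set0 rk m J &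
    (prec m J /\ forall n, D n -> ranked_before set0 rk n J -> prec n J -> n = m \/ prec n m) \/
    (prec J m /\ forall n, D n -> ranked_before set0 rk n J -> prec J n -> n = m \/ prec m n)].
  move=> [//|[->|[a NJ]]] nJ0.
    exists set0; split; [by left|by split => //; left|left; split].
      by split => // e; apply: T0.
    by move=> n _ [_ [->|]]; [left|rewrite rkT ltNge oindex0_le].
  have [b [m Bm [mJ mmax]]] : exists b, exists2 m, B a m &
      side_sub b m J /\ forall n, B a n -> side_sub b n J -> side_sub b n m.
    have [m Bm [mP|mP]] := segments_parent hemb hrange S2 S3 NJ.
      by exists true, m.
    by exists false, m.
  have tot K K' : B a K \/ N a K -> B a K' \/ N a K' -> K `<=` K' \/ K' `<=` K.
    by move=> hK hK'; apply: Dtot; [case: hK|case: hK']; [apply: BN|apply: ND|apply: BN|apply: ND].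
  have [m' Lm' [m'J m'max]] := nearest_earlier (f a J) tot (fP a) (ex_intro2 _ _ m Bm (conj mJ mmax)).
  have LD n : B a n \/ N a n /\ (f a n < f a J)%N -> D n /\ ranked_before set0 rk n J.
    move=> [Bn|[Nn fn]].
      split; first exact: BN Bn.
      split => //; case: Bn => [->|[->|[c ca Nn]]]; [by left|right; exact: rkT_lt NJ|right].
      by rewrite (rkN _ _ NJ) (rkN _ _ Nn) ltxi_pair (ltW ca) /= leNgt ca.
    split; first exact: ND Nn.
    by split => //; right; rewrite (rkN _ _ NJ) (rkN _ _ Nn) ltxi_pair lexx /=.
  have DL n : D n -> ranked_before set0 rk n J -> B a n \/ N a n /\ (f a n < f a J)%N.
    move=> Dn [_ [->|]]; first by left; left.
    case: Dn => [->|[->|[c Nn]]]; [by left; left|by left; right; left|].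
    rewrite (rkN _ _ NJ) (rkN _ _ Nn) ltxi_pair le_eqVlt => /andP[/orP[/eqP ca|ca] hf].
      by subst c; right; split => //; move: hf; rewrite lexx.
    by left; right; right; exists c.
  have [Dm' rm'] := LD _ Lm'.
  have nself : ~ (B a J \/ N a J /\ (f a J < f a J)%N).
    move=> [[|[|[c ca NcJ]]]|[_]]; last by rewrite ltnn.
    - by case: (N0 _ _ NJ).
    - by case: (N0 _ _ NJ).
    - by move: ca; rewrite (segments_unique hemb hrange S2 NcJ NJ) ltxx.
  have m'neq : m' <> J by move=> e; rewrite e in Lm'.
  exists m'; split => //; case: b {mJ mmax} m'J m'max => /= m'J m'max; [left|right]; split.
  - by split.
  - move=> n Dn rn [nJ _]; have [->|nm'] := pselect (n = m'); [by left|right; split => //].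
    by apply: m'max => //; apply: DL.
  - by split => //; apply: nesym.
  - move=> n Dn rn [nJ _]; have [->|nm'] := pselect (n = m'); [by left|right; split].
      by apply: m'max => //; apply: DL.
    exact: nesym.
have [j [j0 jlt jtop]] := ranked_embedding prec_irr prec_trans bot_prec rk_inj parent.
apply: (separating_segments_image cX X0 Ddown _ _ j0).
- by left.
- by right; left.
- rewrite jtop ?rkT //; [by right; left|by move=> y; exact: oindex0_le].
- by move=> J J' DJ DJ' JJ' nJJ'; apply: jlt.
- move=> z x zx; have [a [J [NJ Jz nJx]]] := segments_separate hemb hrange S2 S3 S4 zx.
  by exists J => //; apply: ND NJ.
Qed.

Theorem theorem5p8 (R : realType) :
  exists (d : Order.disp_t) (K : orderTopologicalType d),
    linearly_ordered_valdivia_compact R K /\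
    has_clopen_base K /\
    (nowhere_first_countable K /\
     forall i : interval K, itv_open_ends i -> [set` i] !=set0 ->
       contains_omega1_succ [set` i] /\ contains_succ_omega1_rev [set` i]) /\
    (forall C : set K, clopen C -> C !=set0 ->
       order_isomorphic_to_subset K C) /\
    (forall (e : Order.disp_t) (X : orderTopologicalType e),
       linearly_ordered_valdivia_compact R X -> order_preserving_image K X).
Proof.
exists cut_display, cutspace; split; [|split; [|split; [|split]]].
- split; last exact: cutspace_valdivia.
  have [x x0 x1] := mk_lex_between (lexdelta_gt0 oindex0).
  by have [A _] := mk_cut_le (ltW x0) x1; exists A.
- exact: cutspace_clopen_base.
- split; first exact: cutspace_nowhere_first_countable.
  exact: cutspace_interval_copies.
- exact: clopen_iso.
- move=> e X; exact: valdivia_image.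
Qed.
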